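(* Let $L_m/L_0$, $L_0=k(x)$, be a cyclic extension of degree $p^m$ in which every ramified place is totally ramified, with intermediate tower $L_0\subset L_1\subset\cdots\subset L_m$ in standard form. Fix a place $P_{i_0,0}$ of $L_0$ that ramifies totally in $L_m/L_0$, let $P_j$ be the place of $L_j$ above $P_{i_0,0}$, and let $\lambda_j=\lambda_{i_0,j}$ for $1\le j\le m$. Let $H_{L_j}(P_j)$ be the Weierstrass semigroup of $L_j$ at $P_j$. Then $$H_{L_j}(P_j)\subseteq p^j\mathbb{Z}_++p^{j-1}\lambda_1\mathbb{Z}_++\cdots+\lambda_j\mathbb{Z}_+ .$$ In particular, $$H_{L_m}(P_m)\subseteq p^m\mathbb{Z}_++p^{m-1}\lambda_1\mathbb{Z}_++\cdots+\lambda_m\mathbb{Z}_+ .$$ If moreover $P_{i_0,0}$ is the only place that ramifies in $L_m/L_0$, then these inclusions are equalities.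
   Context: $k$ is an algebraically closed field of characteristic $p>0$; $\mathbb{Z}_+$ is the set of non-negative integers. The Weierstrass semigroup of a function field at a place $Q$ is the set of integers $a\ge 0$ such that some function has pole divisor $aQ$. Standard form (Madden): there is a unique tower of intermediate fields $k(x)=L_0\subset L_1\subset\cdots\subset L_m$ with $[L_j:L_{j-1}]=p$, and generators can be chosen so that $L_j=L_{j-1}(y_j)$, $y_j^p-y_j=B_j$ with $B_j\in L_{j-1}$ and $\mathrm{div}(B_j)=A-\sum_i\lambda_{i,j}P_{i,j-1}$, where $A$ is an (effective) divisor prime to the pole divisor of $B_j$, and each $\lambda_{i,j}$ is either zero or a positive integer prime to $p$. Here $P_{i,j}$ denotes the place of $L_j$ above the $i$-th place of $L_0$ that ramifies in $L_m/L_0$. One has $-\lambda_{i,j}=v_{P_{i,j-1}}(B_j)=v_{P_{i,j}}(y_j)$. *)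

(* Defs.v *)
From HB Require Import structures.
From mathcomp Require Import all_boot all_order all_algebra.
From mathcomp Require Import all_fingroup all_solvable all_field.
From mathcomp Require Import boolp classical_sets.
From mathcomp Require Import freeg.

Set Implicit Arguments.
Unset Strict Implicit.
Unset Printing Implicit Defensive.

Import Order.TTheory GRing.Theory Num.Theory.
Local Open Scope ring_scope.

Notation ratfun k := {fraction {poly k}}.

(* The image in L of a constant of k, along k -> k(x) -> L. *)
Definition cst (k : fieldType) (L : fieldExtType (ratfun k)) (c : k) : L :=
  (tofrac c%:P)%:A.

(* A place of the intermediate field E, given by its normalized discrete
   valuation, which is trivial on the constants and defined on E^*.  It is
   extended by 0 (not +oo) to the rest of L, so that two places are equal as
   soon as their valuations agree on E^*; its value at 0 is meaningless. *)
Record place (k : fieldType) (L : fieldExtType (ratfun k)) (E : {subfield L}) :=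
  Place {
    val_at :> L -> int;
    val_at_out : forall z, ~~ ((z \in E) && (z != 0)) -> val_at z = 0;
    val_atM : forall y z, y \in E -> z \in E -> y != 0 -> z != 0 ->
      val_at (y * z) = val_at y + val_at z;
    val_atD : forall y z, y \in E -> z \in E -> y != 0 -> z != 0 ->
      y + z != 0 -> Num.min (val_at y) (val_at z) <= val_at (y + z);
    val_at_cst : forall c : k, c != 0 -> val_at (cst L c) = 0;
    val_at_uniformizer : exists2 t, t \in E & val_at t = 1
  }.

HB.instance Definition _ (k : fieldType) (L : fieldExtType (ratfun k))
  (E : {subfield L}) := gen_eqMixin (place E).
HB.instance Definition _ (k : fieldType) (L : fieldExtType (ratfun k))
  (E : {subfield L}) := gen_choiceMixin (place E).

Section Places.

Variables (k : fieldType) (L : fieldExtType (ratfun k)).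
Implicit Types F E : {subfield L}.

(* For F contained in E: the place Q of E lies over the place P of F, with
   ramification index e. *)
Definition ram_index F E (P : place F) (Q : place E) (e : nat) : Prop :=
  (0 < e)%N /\ forall z, z \in F -> z != 0 -> Q z = e%:Z * P z.

Definition lies_over F E (P : place F) (Q : place E) : Prop :=
  exists e, ram_index P Q e.

Definition ramified F E (P : place F) : Prop :=
  exists (Q : place E) (e : nat), ram_index P Q e /\ (1 < e)%N.

Definition totally_ramified F E (P : place F) : Prop :=
  exists Q : place E,
    ram_index P Q (\dim_F E) /\ forall Q' : place E, lies_over P Q' -> Q' = Q.

Definition divisor E := {freeg (place E) / int}.

Definition is_div E (f : L) (D : divisor E) : Prop :=
  forall Q : place E, coeff Q D = Q f.

Definition is_pole_div E (f : L) (D : divisor E) : Prop :=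
  forall Q : place E, coeff Q D = Num.max 0 (- Q f).

Definition effective E (D : divisor E) : Prop :=
  forall Q : place E, 0 <= coeff Q D.

Definition disjoint_div E (D D' : divisor E) : Prop :=
  forall Q : place E, coeff Q D = 0 \/ coeff Q D' = 0.

Definition weierstrass_semigroup E (Q : place E) : set nat :=
  [set a | exists f : L,
     [/\ f \in E, f != 0 & is_pole_div f (<< a%:Z *g Q >> : divisor E)]]%classic.

(* A tower k(x) = T 0 < T 1 < ... < T m = L whose steps have degree p; the
   values of T beyond m are irrelevant. *)
Definition degree_p_tower (p m : nat) (T : nat -> {subfield L}) : Prop :=
  [/\ T 0%N = 1%AS, T m = {: L}%AS &
      forall j, (j < m)%N ->
        (T j <= T j.+1)%VS /\ (\dim_(T j) (T j.+1) = p)%N].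

(* The places P i 0 list, without repetition, the places of T 0 that ramify in
   T m, and P i j lies over P i 0. *)
Definition ramified_places (m : nat) (T : nat -> {subfield L}) (s : nat)
    (P : 'I_s -> forall j, place (T j)) : Prop :=
  [/\ injective (fun i => P i 0%N),
      forall Q : place (T 0%N), ramified (T m) Q <-> exists i, Q = P i 0%N &
      forall i j, (j <= m)%N -> lies_over (P i 0%N) (P i j)].

(* y j, B j and lam i j are only relevant for 1 <= j <= m. *)
Definition standard_form (p m : nat) (T : nat -> {subfield L}) (s : nat)
    (P : 'I_s -> forall j, place (T j))
    (y B : nat -> L) (lam : 'I_s -> nat -> nat) : Prop :=
  forall j, (j < m)%N ->
    [/\ T j.+1 = <<T j; y j.+1>>%AS,
        y j.+1 ^+ p - y j.+1 = B j.+1,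
        B j.+1 \in T j /\ B j.+1 != 0,
        exists A Binf : divisor (T j),
          [/\ effective A,
              is_pole_div (B j.+1) Binf,
              disjoint_div A Binf &
              is_div (B j.+1)
                (A - \sum_(i < s) << (lam i j.+1)%:Z *g P i j >>)] &
        forall i, lam i j.+1 = 0%N \/ ((0 < lam i j.+1)%N /\ coprime (lam i j.+1) p)].

End Places.

(* p^j Z_+ + p^(j-1) lam_1 Z_+ + ... + lam_j Z_+ *)
Definition ramification_semigroup (p : nat) (lam : nat -> nat) (j : nat) :
    set nat :=
  [set a | exists c : nat -> nat,
     a = (p ^ j * c 0 + \sum_(1 <= l < j.+1) p ^ (j - l) * lam l * c l)%N]%classic.

(* Main.v *)
From HB Require Import structures.
Require Import Defs.
From mathcomp Require Import all_boot all_order all_algebra.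
From mathcomp Require Import all_fingroup all_solvable all_field.
From mathcomp Require Import boolp classical_sets.
From mathcomp Require Import zify ring generic_quotient freeg.

Set Implicit Arguments.
Unset Strict Implicit.
Unset Printing Implicit Defensive.

Import Order.TTheory GRing.Theory Num.Theory.
Local Open Scope ring_scope.

(** Write [v] for the value at the chosen place.  Each step of the tower adjoins
    a root [y] of an Artin-Schreier equation [y ^+ p - y = B], and an element of
    the upper field is a polynomial in [y] of degree less than [p] over the lower
    one.  Three facts give the inclusion by induction along the tower.

    At a listed place every step is totally ramified and [y] has value [- lam]
    with [lam] prime to [p] ([P_step_ram], [P_step_y]).  Hence the terms
    [g_n * y ^+ n] of [f] have distinct values [p * v(g_n) - n * lam] modulo [p],
    and the value of [f] is the least of them ([P_expand]).

    If [f] has no pole away from the chosen place, neither has any coefficient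
    [g_n] ([coef_regular]).  At another listed place this follows from the
    formula for the values.  At any other place [B] is regular; there the
    equation splits into linear factors over the completion, which yields [p]
    distinct places above ([AS_split_place]), and a polynomial of degree less
    than [p] whose values at these [p] points are integral has integral
    coefficients ([AS_integral]).

    At the bottom of the tower, a rational function without poles is constant
    ([mem1_no_pole]), so that one whose only possible pole is the chosen place
    has value at most 0 there.

    The total ramification of the steps comes from that of the whole tower.  A
    place of an intermediate field over a listed place is determined by the
    unique place [W] of [L] above it, because the conjugates of an element have
    the same value at [W] ([over_top]).  If [y] were regular at [W], it would have
    a constant residue, fixed by conjugation, while the conjugates of [y] differ
    by nonzero constants; so [y] has a pole at [W] ([y_pole]), and comparing the
    values of [y] and [B] shows that each step contributes a factor [p] to the
    ramification index ([ram_step]).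

    Conversely, if only one place ramifies, the products of powers of the
    generators and of a rational function with a simple pole there have no other
    pole, and their values exhaust the semigroup ([semigroup_value]). *)

(** * Constants and rational functions inside the extension *)

Lemma fracE (R : idomainType) (z : {fraction R}) :
  exists2 q : R * R, q.2 != 0 & z = tofrac q.1 / tofrac q.2.
Proof.
elim/generic_quotient.quotW: z => x; exists (\n_x, \d_x) => /=; first exact: denom_ratioP.
have d0 : tofrac \d_x != 0 by rewrite tofrac_eq0 denom_ratioP.
apply: (canRL (mulfK d0)).
unlock tofrac; rewrite /= -[LHS]fraction.FracField.pi_mul.
apply/eqP; rewrite [_ == _]fraction.FracField.equivf_def /fraction.FracField.mulf.
by rewrite !numden_Ratio ?mulf_neq0 ?oner_eq0 ?denom_ratioP // !mulr1 mulrC.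
Qed.

Section Constants.
Variables (k : fieldType) (L : fieldExtType (ratfun k)).

Definition poly_in : {poly k} -> L := in_alg L \o @tofrac _.
HB.instance Definition _ := GRing.RMorphism.on poly_in.

Arguments poly_in : simpl never.

Lemma poly_in0 : poly_in 0 = 0. Proof. exact: rmorph0. Qed.
Lemma poly_in1 : poly_in 1 = 1. Proof. exact: rmorph1. Qed.
Lemma poly_inM : {morph poly_in : f g / f * g}. Proof. exact: rmorphM. Qed.
Lemma poly_inB : {morph poly_in : f g / f - g}. Proof. exact: rmorphB. Qed.

Lemma cstE (c : k) : cst L c = poly_in c%:P.
Proof. by []. Qed.

Fact cst_zmod_morphism : zmod_morphism (cst L).
Proof. by move=> a b; rewrite !cstE polyCB poly_inB. Qed.

Fact cst_monoid_morphism : monoid_morphism (cst L).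
Proof. by split=> [|a b]; rewrite !cstE ?poly_in1 // polyCM poly_inM. Qed.

HB.instance Definition _ := GRing.isZmodMorphism.Build k L (cst L) cst_zmod_morphism.
HB.instance Definition _ := GRing.isMonoidMorphism.Build k L (cst L) cst_monoid_morphism.

Lemma cst_eq0 c : (cst L c == 0) = (c == 0).
Proof. exact: fmorph_eq0. Qed.

Lemma poly_in_eq0 f : (poly_in f == 0) = (f == 0).
Proof. by rewrite (fmorph_eq0 (in_alg L)) tofrac_eq0. Qed.

Lemma poly_in_mem1 f : poly_in f \in 1%VS.
Proof. by rewrite [poly_in f]/(in_alg L _) /= memvZ ?mem1v. Qed.

Lemma poly_in_mem (E : {subfield L}) f : poly_in f \in E.
Proof. exact: (subvP (sub1v E)) (poly_in_mem1 f). Qed.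

Lemma cst_mem (E : {subfield L}) c : cst L c \in E.
Proof. exact: poly_in_mem. Qed.

Lemma mem1_fracE z : z \in 1%VS ->
  exists2 q : {poly k} * {poly k}, q.2 != 0 & z = poly_in q.1 / poly_in q.2.
Proof.
case/vlineP=> a ->; have [q q2 ->] := fracE a.
by exists q; rewrite // -[in LHS]/(in_alg L _) fmorph_div.
Qed.

(** * Computing with values *)

Section PlaceTheory.
Variables (E : {subfield L}) (Q : place E).
Implicit Types (y z : L) (n : int).

Lemma val0 : Q 0 = 0.
Proof. by rewrite val_at_out // eqxx andbF. Qed.

Lemma val1 : Q 1 = 0.
Proof. by rewrite -(val_at_cst Q (oner_neq0 k)) cstE !rmorph1. Qed.

Lemma valN z : z \in E -> Q (- z) = Q z.
Proof.
move=> Ez; have [->|z0] := eqVneq z 0; first by rewrite oppr0.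
rewrite -mulN1r val_atM ?rpredN ?rpred1 ?oppr_eq0 ?oner_eq0 //.
have := @val_at_cst _ _ _ Q (-1).
by rewrite cstE !rmorphN !rmorph1 oppr_eq0 oner_eq0 => /(_ isT) ->; rewrite add0r.
Qed.

Lemma valV z : z \in E -> Q z^-1 = - Q z.
Proof.
move=> Ez; have [->|z0] := eqVneq z 0; first by rewrite invr0 val0.
apply/eqP; rewrite -addr_eq0 -val_atM ?rpredV ?invr_eq0 //.
by rewrite mulVf // val1.
Qed.

Lemma val_div y z : y \in E -> z \in E -> y != 0 -> z != 0 ->
  Q (y / z) = Q y - Q z.
Proof. by move=> *; rewrite val_atM ?rpredV ?invr_eq0 // valV. Qed.

Lemma valX z i : z \in E -> z != 0 -> Q (z ^+ i) = i%:Z * Q z.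
Proof.
move=> Ez z0; elim: i => [|i IH]; first by rewrite val1 mul0r.
by rewrite exprS val_atM ?rpredX ?expf_neq0 // IH intS mulrDl mul1r.
Qed.

Lemma valXz z (n : int) : z \in E -> z != 0 -> Q (z ^ n) = n * Q z.
Proof.
move=> Ez z0; case: n => i; first exact: valX.
by rewrite NegzE -exprz_inv -exprnP valX ?rpredV ?invr_eq0 // valV // mulrN mulNr.
Qed.

(** A place gives the value 0 to the zero element; this predicate restores the
    usual convention that [0] has infinite value. *)
Definition vge n z := (z == 0) || (n <= Q z).

Lemma vge0 n : vge n 0.
Proof. by rewrite /vge eqxx. Qed.

Lemma vgeE n z : z != 0 -> vge n z = (n <= Q z).
Proof. by rewrite /vge => /negPf->. Qed.

Lemma vge_le n n' z : n' <= n -> vge n z -> vge n' z.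
Proof. by rewrite /vge => le_n /orP[->//|nz]; rewrite (le_trans le_n nz) orbT. Qed.

Lemma vgeN n z : z \in E -> vge n (- z) = vge n z.
Proof. by move=> Ez; rewrite /vge oppr_eq0 valN. Qed.

Lemma vgeD n y z : y \in E -> z \in E -> vge n y -> vge n z -> vge n (y + z).
Proof.
move=> Ey Ez; have [->|y0] := eqVneq y 0; first by rewrite add0r.
have [->|z0] := eqVneq z 0; first by rewrite addr0.
have [->|yz0] := eqVneq (y + z) 0; first by rewrite vge0.
rewrite !vgeE // => ny nz; apply: le_trans (val_atD Q Ey Ez y0 z0 yz0).
by rewrite le_min ny.
Qed.

Lemma vgeB n y z : y \in E -> z \in E -> vge n y -> vge n z -> vge n (y - z).
Proof. by move=> Ey Ez ny nz; rewrite vgeD ?rpredN ?vgeN. Qed.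

Lemma vgeM n n' y z : y \in E -> z \in E -> vge n y -> vge n' z ->
  vge (n + n') (y * z).
Proof.
move=> Ey Ez; have [->|y0] := eqVneq y 0; first by rewrite mul0r !vge0.
have [->|z0] := eqVneq z 0; first by rewrite mulr0 !vge0.
by rewrite !vgeE ?mulf_neq0 // val_atM //; apply: lerD.
Qed.

Lemma vge0M y z : y \in E -> z \in E -> vge 0 y -> vge 0 z -> vge 0 (y * z).
Proof. by move=> *; rewrite -[0]addr0 vgeM. Qed.

Lemma vge_div n y z : y \in E -> z \in E -> z != 0 -> vge n y -> vge (n - Q z) (y / z).
Proof.
move=> Ey Ez z0 ny; rewrite vgeM ?rpredV // vgeE ?invr_eq0 //.
by rewrite valV.
Qed.

Lemma vge1 : vge 0 1.
Proof. by rewrite /vge val1 lexx orbT. Qed.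

Lemma vge0X i z : z \in E -> vge 0 z -> vge 0 (z ^+ i).
Proof.
by move=> Ez z0; elim: i => [|i IH]; rewrite ?vge1 // exprS vge0M ?rpredX.
Qed.

Lemma vge_sum (I : Type) (r : seq I) (A : pred I) (F : I -> L) n :
    (forall i, A i -> F i \in E) -> (forall i, A i -> vge n (F i)) ->
  vge n (\sum_(i <- r | A i) F i).
Proof.
move=> EF nF; suff [//] : \sum_(i <- r | A i) F i \in E /\ vge n (\sum_(i <- r | A i) F i).
elim/big_rec: _ => [|i z Ai [Ez nz]]; first by rewrite rpred0 vge0.
by rewrite rpredD ?vgeD ?EF ?nF.
Qed.

Lemma vge_cst c : vge 0 (cst L c).
Proof.
have [->|c0] := eqVneq c 0; first by rewrite cstE !rmorph0 vge0.
by rewrite /vge val_at_cst // lexx orbT.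
Qed.

(** A strict inequality of values leaves no room for cancellation: apply the
    triangle inequality to [z + d] and to [z = (z + d) - d]. *)
Lemma val_addr z d : z \in E -> d \in E -> z != 0 -> vge (Q z + 1) d ->
  z + d != 0 /\ Q (z + d) = Q z.
Proof.
move=> Ez Ed z0; have [->|d0] := eqVneq d 0; first by rewrite addr0.
rewrite vgeE // => le_d.
have zd0 : z + d != 0.
  by apply/eqP=> /eqP; rewrite addr_eq0 => /eqP zd; move: le_d; rewrite zd valN; lia.
split=> //; have := val_atD Q Ez Ed z0 d0 zd0.
have := @val_atD _ _ _ Q (z + d) (- d); rewrite addrK rpredN rpredD // oppr_eq0 valN //.
move=> /(_ isT Ed zd0 d0 z0); rewrite !ge_min; move: le_d.
by move: (Q z) (Q d) (Q (z + d)) => *; lia.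
Qed.

Lemma vge_horner n (G : {poly L}) b : G \is a polyOver E -> b \in E ->
  (forall i, vge n G`_i) -> vge 0 b -> vge n G.[b].
Proof.
move=> /polyOverP EG Eb nG b0; rewrite horner_coef vge_sum // => i _.
  by rewrite rpredM ?rpredX.
by rewrite -[n]addr0 vgeM ?rpredX ?vge0X.
Qed.

End PlaceTheory.

End Constants.

Section MorePlaces.
Variables (k : fieldType) (L : fieldExtType (ratfun k)).
Implicit Types (E F : {subfield L}).

Lemma mem_exprz F z (n : int) : z \in F -> z ^ n \in F.
Proof.
by move=> Fz; case: n => i; rewrite ?NegzE -?exprnP -?exprz_inv -?exprnP ?rpredX ?rpredV.
Qed.

Lemma uniformizerE E (Q : place E) : exists t, [/\ t \in E, t != 0 & Q t = 1].
Proof.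
have [t Et Qt] := val_at_uniformizer Q; exists t; split=> //.
by apply: contra_eq_neq Qt => ->; rewrite val0.
Qed.

Lemma place_eq E (Q Q' : place E) :
  (forall z, z \in E -> z != 0 -> Q z = Q' z) -> Q = Q'.
Proof.
move=> eqQ; have {}eqQ : val_at Q = val_at Q'.
  apply/funext => z; case: (boolP ((z \in E) && (z != 0))) => [/andP[]|out].
    exact: eqQ.
  by rewrite !val_at_out.
case: Q Q' eqQ => [v p1 p2 p3 p4 p5] [v' q1 q2 q3 q4 q5] /= eqv.
by case: _ / eqv in q1 q2 q3 q4 q5 *; congr Place; apply: Prop_irrelevance.
Qed.

(** Evaluating on uniformizers of [P] and of [P'] shows that each index divides
    the other. *)
Lemma ram_index_inj F E (P P' : place F) (Q : place E) e e' :
  ram_index P Q e -> ram_index P' Q e' -> P = P' /\ e = e'.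
Proof.
case=> e0 QP [e0' QP']; have eqe : e = e'.
  have [t [Ft t0 Pt]] := uniformizerE P; have [t' [Ft' t0' Pt']] := uniformizerE P'.
  have := QP' _ Ft t0; rewrite QP // Pt; have := QP _ Ft' t0'; rewrite QP' // Pt'.
  move: (P t') (P' t); clear -e0 e0' => a b ea eb.
  have a0 : 0 < a by nia.
  have b0 : 0 < b by nia.
  by nia.
split=> //; apply: place_eq => z Fz z0; apply: (@mulfI _ e%:Z).
  by rewrite eqz_nat -lt0n.
by rewrite -QP // eqe -QP'.
Qed.

Lemma ram_index_trans F K E (P : place F) (Q : place K) (W : place E) e e' :
  (F <= K)%VS -> ram_index P Q e -> ram_index Q W e' -> ram_index P W (e' * e)%N.
Proof.
move=> FK [e0 QP] [e0' WQ]; split=> [|z Fz z0]; first by rewrite muln_gt0 e0'.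
by rewrite WQ ?(subvP FK) // QP // PoszM mulrA.
Qed.

Lemma ex_min_val E (Q : place E) (I : finType) (u : I -> L) (i0 : I) :
  u i0 != 0 -> exists2 i, u i != 0 & forall j, vge Q (Q (u i)) (u j).
Proof.
move=> u0; case: (arg_minP (P := fun i => u i != 0) (fun i => Q (u i)) u0) => i ui min_i.
by exists i => // j; rewrite /vge; case: eqP => //= /eqP; apply: min_i.
Qed.

(** Division by a coefficient of least value makes a polynomial integral with a
    coefficient equal to 1, so that its reduction is nonzero. *)
Lemma ex_min_coef E (Q : place E) (G : {poly L}) : G != 0 ->
  exists2 i, G`_i != 0 & forall j, vge Q (Q G`_i) G`_j.
Proof.
move=> G0; have lt_n : ((size G).-1 < size G)%N by rewrite prednK ?size_poly_gt0.
have u0 : G`_(Ordinal lt_n) != 0 by rewrite -/(lead_coef G) lead_coef_eq0.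
have [i ci min_i] := ex_min_val Q (u := fun j : 'I_(size G) => G`_j) u0.
exists i => // j; case: (ltnP j (size G)) => [lt_j|le_j]; first exact: (min_i (Ordinal lt_j)).
by rewrite [G`_j]nth_default ?vge0.
Qed.

(** By the strict triangle inequality, a sum of terms of distinct values has the
    least of these values. *)
Lemma val_sum_distinct E (Q : place E) (I : finType) (u : I -> L) (i0 : I) :
    u i0 != 0 -> (forall i, u i \in E) ->
    (forall i j, u i != 0 -> u j != 0 -> Q (u i) = Q (u j) -> i = j) ->
  exists i, [/\ u i != 0, forall j, vge Q (Q (u i)) (u j),
                \sum_j u j != 0 & Q (\sum_j u j) = Q (u i)].
Proof.
move=> u0 Eu inj_u; have [i ui min_i] := ex_min_val Q u0; exists i.
rewrite (bigD1 i) //=; suff [-> ->] :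
    u i + \sum_(j | j != i) u j != 0 /\ Q (u i + \sum_(j | j != i) u j) = Q (u i).
  by split.
apply: val_addr => //; first by rewrite rpred_sum.
apply: vge_sum => // j ji; have := min_i j; rewrite /vge; case: eqP => //= /eqP uj.
rewrite le_eqVlt => /predU1P[eq_ij|lt_ij].
  by rewrite (inj_u _ _ ui uj eq_ij) eqxx in ji.
by rewrite lezD1.
Qed.

(** Valuation rings are integrally closed: if [z] had a pole, the leading term of
    [G.[z]] would have strictly smaller value than all the others. *)
Lemma vge0_root E (Q : place E) (G : {poly L}) z :
    G \is a polyOver E -> G \is monic -> (forall i, vge Q 0 G`_i) ->
    z \in E -> root G z ->
  vge Q 0 z.
Proof.
move=> /polyOverP EG monG G0 Ez rGz; have [->|z0] := eqVneq z 0; first exact: vge0.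
rewrite vgeE // leNgt; apply/negP => Qz.
have sG : (1 < size G)%N by apply: root_size_gt1 rGz; rewrite monic_neq0.
have [n sGn] : exists n, size G = n.+2 by exists (size G).-2; lia.
suff [] : z ^+ n.+1 + \sum_(i < n.+1) G`_i * z ^+ i != 0 /\
          Q (z ^+ n.+1 + \sum_(i < n.+1) G`_i * z ^+ i) = Q (z ^+ n.+1).
  move: rGz; rewrite /root horner_coef sGn big_ord_recr /=.
  have -> : G`_n.+1 = 1 by move/monicP: monG; rewrite /lead_coef sGn.
  by rewrite mul1r addrC => ->.
apply: val_addr; rewrite ?rpredX ?expf_neq0 //.
  by apply: rpred_sum => i _; rewrite rpredM ?rpredX.
apply: vge_sum => i _; first by rewrite rpredM ?rpredX.
apply: (@vge_le _ _ _ _ (0 + Q (z ^+ i))).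
  rewrite !valX //; move: (ltn_ord i) Qz; move: (Q z) (nat_of_ord i) => q j.
  by clear; nia.
by apply: vgeM; rewrite ?rpredX // vgeE ?expf_neq0.
Qed.

(** If the restriction were trivial, every element of [E], being algebraic over
    [F], would be integral at [Q]. *)
Lemma place_nontrivial E F (Q : place E) : (F <= E)%VS ->
  exists z, [/\ z \in F, z != 0 & Q z != 0].
Proof.
move=> FE; apply: contrapT => Q0; have [t [Et t0 Qt]] := uniformizerE Q.
have : vge Q 0 t^-1.
  apply: (@vge0_root _ _ (minPoly F t^-1)); rewrite ?rpredV ?root_minPoly ?monic_minPoly //.
    by apply: polyOverS (minPolyOver _ _); apply: subvP.
  move=> i; have Fi : (minPoly F t^-1)`_i \in F by move/polyOverP: (minPolyOver F t^-1).
  rewrite /vge; case: eqP => //= /eqP ci; rewrite le_eqVlt; apply/orP; left.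
  apply: contrapT => Qc; apply: Q0; exists (minPoly F t^-1)`_i.
  by split=> //; rewrite eq_sym; apply/negP.
by rewrite vgeE ?invr_eq0 // valV // Qt.
Qed.

(** The values taken on [F] form a nonzero group of integers; dividing by its
    positive generator [e] normalizes the restriction. *)
Lemma place_restrict E F (Q : place E) : (F <= E)%VS ->
  exists P : place F, lies_over P Q.
Proof.
move=> FE; have FEs := subvP FE.
have ex_e : exists e : nat, `[< (0 < e)%N /\ exists z, [/\ z \in F, z != 0 & Q z = e%:Z] >].
  have [z [Fz z0 Qz]] := place_nontrivial Q FE; exists `|Q z|%N; apply/asboolP.
  split; first by rewrite absz_gt0.
  have [Q0|Q0] := lerP 0 (Q z); first by exists z; split=> //; rewrite gez0_abs.
  exists z^-1; split; rewrite ?rpredV ?invr_eq0 ?valV ?FEs //.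
  by rewrite ltz0_abs.
case: (ex_minnP ex_e) => e /asboolP[e0 [w [Fw w0 Qw]]] min_e.
have Qdiv z : z \in F -> z != 0 -> Q z = e%:Z * (Q z %/ e%:Z)%Z.
  move=> Fz z0; have ez : e%:Z != 0 by rewrite eqz_nat -lt0n.
  have := divz_eq (Q z) e%:Z; set q := (Q z %/ e)%Z; set r := (Q z %% e)%Z => Qz.
  suff r0 : r = 0 by rewrite Qz r0 addr0 mulrC.
  have r_ge0 : 0 <= r by rewrite modz_ge0.
  have r_lt : r < e%:Z by rewrite ltz_pmod.
  apply: contrapT => rn0; have : (e <= `|r|)%N.
    apply: min_e; apply/asboolP; split; first by lia.
    exists (z * w ^ (- q)); split.
    - by rewrite rpredM // mem_exprz.
    - by rewrite mulf_neq0 // expfz_neq0.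
    - rewrite val_atM ?valXz ?FEs ?mem_exprz ?expfz_neq0 // Qw Qz; first by lia.
  by lia.
pose v z := if (z \in F) && (z != 0) then (Q z %/ e%:Z)%Z else 0.
have ez : 0 < e%:Z :> int by [].
have vE z : z \in F -> z != 0 -> Q z = e%:Z * v z.
  by move=> Fz z0; rewrite /v Fz z0 -Qdiv.
have ezI : injective ( *%R e%:Z) by apply: mulfI; rewrite gt_eqF.
have v1 z : ~~ ((z \in F) && (z != 0)) -> v z = 0 by rewrite /v => /negPf->.
have v2 y z : y \in F -> z \in F -> y != 0 -> z != 0 -> v (y * z) = v y + v z.
  move=> Fy Fz y0 z0; apply: ezI; rewrite mulrDr -!vE ?rpredM ?mulf_neq0 //.
  by rewrite val_atM ?FEs.
have v3 y z : y \in F -> z \in F -> y != 0 -> z != 0 -> y + z != 0 ->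
    Num.min (v y) (v z) <= v (y + z).
  move=> Fy Fz y0 z0 yz0; have := val_atD Q (FEs _ Fy) (FEs _ Fz) y0 z0 yz0.
  by rewrite !vE ?rpredD // !ge_min !ler_pM2l.
have v4 c : c != 0 -> v (cst L c) = 0.
  move=> c0; have cn0 : cst L c != 0 by rewrite cstE poly_in_eq0 polyC_eq0.
  by apply: ezI; rewrite -vE ?cstE ?poly_in_mem // -cstE val_at_cst // mulr0.
have v5 : exists2 t, t \in F & v t = 1.
  by exists w => //; apply: ezI; rewrite -vE // Qw mulr1.
by exists (Place v1 v2 v3 v4 v5), e; split.
Qed.

End MorePlaces.

(** * The places of the rational function field *)

Section RationalPlaces.
Variables (k : fieldType) (L : fieldExtType (ratfun k)).

(** The value of [f / g] is [mu f - mu g], which does not depend on the chosen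
    representation since [mu] is multiplicative. *)
Lemma place_of_poly (mu : {poly k} -> int) :
    (forall f g, f != 0 -> g != 0 -> mu (f * g) = mu f + mu g) ->
    (forall f g, f != 0 -> g != 0 -> f + g != 0 ->
       Num.min (mu f) (mu g) <= mu (f + g)) ->
    (forall c : k, c != 0 -> mu c%:P = 0) ->
    (exists f g, [/\ f != 0, g != 0 & mu f - mu g = 1]) ->
  exists Q : place (1%AS : {subfield L}),
    forall f, f != 0 -> Q (poly_in L f) = mu f.
Proof.
move=> muM muD muC [tf [tg [tf0 tg0 mut]]].
have /boolp.choice[v vP] : forall z, exists n : int,
    (~~ ((z \in 1%VS) && (z != 0)) -> n = 0) /\
    (forall f g, f != 0 -> g != 0 -> z = poly_in L f / poly_in L g ->
       n = mu f - mu g).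
  move=> z.
  case: (boolP ((z \in 1%VS) && (z != 0))) => [/andP[z1 z0]|out]; last first.
    exists 0; split=> // f g f0 g0 zE; case/negP: out; rewrite zE.
    by rewrite rpred_div ?poly_in_mem1 // mulf_neq0 ?invr_eq0 ?poly_in_eq0.
  have [[f g] /= g0 zE] := mem1_fracE z1; exists (mu f - mu g); split=> //.
  move=> f' g' f0' g0' zE'; have f0 : f != 0.
    by apply: contraNneq z0 => f0; rewrite zE f0 rmorph0 mul0r.
  have : f * g' = f' * g.
    apply/eqP; rewrite -subr_eq0 -(poly_in_eq0 L) rmorphB !rmorphM subr_eq0.
    by rewrite -eqr_div ?poly_in_eq0 // -zE zE'.
  move/(congr1 mu); rewrite !muM // => /eqP; lia.
have vE f g : f != 0 -> g != 0 -> v (poly_in L f / poly_in L g) = mu f - mu g.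
  by move=> f0 g0; apply: (vP _).2.
have fracP z : z \in 1%VS -> z != 0 -> exists f g,
    [/\ f != 0, g != 0 & z = poly_in L f / poly_in L g].
  move=> z1 z0; have [[f g] /= g0 zE] := mem1_fracE z1; exists f, g; split=> //.
  by apply: contraNneq z0 => f0; rewrite zE f0 rmorph0 mul0r.
have mu1 : mu 1 = 0 by rewrite -(muC 1) ?oner_eq0.
have v1 z : ~~ ((z \in 1%AS) && (z != 0)) -> v z = 0 by apply: (vP z).1.
have v2 y z : y \in 1%AS -> z \in 1%AS -> y != 0 -> z != 0 -> v (y * z) = v y + v z.
  move=> y1 z1 /(fracP _ y1)[f [g [f0 g0 ->]]] /(fracP _ z1)[f' [g' [f0' g0' ->]]].
  by rewrite mulf_div -!rmorphM !vE ?mulf_neq0 // !muM // opprD addrACA.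
have v3 y z : y \in 1%AS -> z \in 1%AS -> y != 0 -> z != 0 -> y + z != 0 ->
    Num.min (v y) (v z) <= v (y + z).
  move=> y1 z1 /(fracP _ y1)[f [g [f0 g0 ->]]] /(fracP _ z1)[f' [g' [f0' g0' ->]]].
  rewrite addf_div ?poly_in_eq0 // -!rmorphM -rmorphD => s0.
  have {}s0 : f * g' + f' * g != 0.
    by apply: contraNneq s0 => ->; rewrite rmorph0 mul0r.
  rewrite !vE ?mulf_neq0 //; have := muD _ _ _ _ s0; rewrite !mulf_neq0 // => /(_ isT isT).
  rewrite !muM // !ge_min.
  by move: (mu _) (mu f) (mu f') (mu g) (mu g') => *; lia.
have v4 c : c != 0 -> v (cst L c) = 0.
  move=> c0; have := @vE c%:P 1; rewrite rmorph1 divr1 polyC_eq0 c0 oner_eq0 cstE.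
  by move=> -> //; rewrite muC // mu1.
have v5 : exists2 t, t \in 1%AS & v t = 1.
  exists (poly_in L tf / poly_in L tg); rewrite ?vE //.
  by rewrite rpred_div ?poly_in_mem1.
exists (Place v1 v2 v3 v4 v5) => f f0 /=.
by have := @vE f 1; rewrite rmorph1 divr1 oner_eq0 mu1 subr0 => ->.
Qed.

Lemma place_at (c : k) : exists Q : place (1%AS : {subfield L}),
  forall f, f != 0 -> Q (poly_in L f) = (mup c f)%:Z.
Proof.
apply: (place_of_poly (mu := fun f => (mup c f)%:Z)).
- by move=> f g f0 g0; rewrite mupM.
- move=> f g f0 g0 fg0; rewrite ge_min !lez_nat !mup_geq //.
  case: (leqP (mup c f) (mup c g)) => [le_fg|/ltnW le_gf]; apply/orP; [left|right].
    by apply: dvdp_add; rewrite -mup_geq.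
  by apply: dvdp_add; rewrite -mup_geq.
- by move=> a a0; rewrite mupNroot // rootC.
- exists ('X - c%:P), 1; rewrite polyXsubC_eq0 oner_eq0; split=> //.
  by rewrite -['X - _]expr1 mup_XsubCX eqxx mupNroot // rootC oner_eq0.
Qed.

Lemma place_infty : exists Q : place (1%AS : {subfield L}),
  forall f, f != 0 -> Q (poly_in L f) = 1 - (size f)%:Z.
Proof.
apply: (place_of_poly (mu := fun f => 1 - (size f)%:Z)).
- move=> f g f0 g0; rewrite size_mul //.
  move: f0 g0; rewrite -!size_poly_gt0; move: (size f) (size g) => a b *; lia.
- move=> f g f0 g0 fg0; rewrite ge_min; have := size_polyD f g.
  by move: (size _) (size f) (size g) => *; lia.
- by move=> a a0; rewrite size_polyC a0.
- by exists 1, 'X; rewrite oner_eq0 polyX_eq0 size_polyX size_poly1.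
Qed.

Lemma mem1_coprimeE z : z \in 1%VS -> exists f g : {poly k},
  [/\ g != 0, coprimep f g & z = poly_in L f / poly_in L g].
Proof.
case/mem1_fracE=> -[f g] /= g0 ->.
have d0 : gcdp f g != 0 by rewrite gcdp_eq0 (negPf g0) andbF.
exists (f %/ gcdp f g), (g %/ gcdp f g).
have fE := divpK (dvdp_gcdl f g); have gE := divpK (dvdp_gcdr f g).
have g'0 : g %/ gcdp f g != 0.
  by apply: contraNneq g0 => g'0; rewrite -gE g'0 mul0r.
split=> //; first by rewrite coprimep_div_gcd ?g0 ?orbT.
apply/eqP; rewrite eqr_div ?poly_in_eq0 // -!rmorphM; apply/eqP; congr poly_in.
by apply: (mulIf d0); rewrite -mulrA gE mulrAC fE.
Qed.

End RationalPlaces.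

(** Complete splitting is the form in which closedness is used: it reduces the
    values of polynomials to those of linear factors. *)
Definition alg_closed (k : fieldType) : Prop :=
  forall f : {poly k}, exists r : seq k, f = lead_coef f *: \prod_(z <- r) ('X - z%:P).

Lemma alg_closed_root (k : fieldType) (f : {poly k}) : alg_closed k -> size f != 1%N ->
  exists c, root f c.
Proof.
move=> kcl sf; have [->|f0] := eqVneq f 0; first by exists 0; rewrite root0.
have [[|c r] fE] := kcl f; last first.
  by exists c; rewrite fE rootZ ?lead_coef_eq0 // root_prod_XsubC mem_head.
by move: sf; rewrite fE big_nil size_scale ?lead_coef_eq0 // size_poly1.
Qed.

Section ClosedConstants.
Variables (k : fieldType) (L : fieldExtType (ratfun k)) (kcl : alg_closed k).
Implicit Types (E F : {subfield L}).

Definition lin (c : k) : L := poly_in L ('X - c%:P).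

Lemma lin_neq0 c : lin c != 0.
Proof. by rewrite poly_in_eq0 polyXsubC_eq0. Qed.

Lemma lin_in E c : lin c \in E.
Proof. exact: poly_in_mem. Qed.

Lemma linB c c' : lin c' = lin c + cst L (c - c').
Proof. by rewrite /lin cstE -rmorphD /= polyCB addrA subrK. Qed.

(** Two places can be compared on the linear polynomials alone, since every
    polynomial splits and constants have value 0. *)
Lemma val_poly_lin E F (Q : place E) (V : place F) (e : int) :
    (forall c, Q (lin c) = e * V (lin c)) ->
  forall f, f != 0 -> Q (poly_in L f) = e * V (poly_in L f).
Proof.
move=> eqQV f f0; have [r ->] := kcl f.
move: f0; rewrite -lead_coef_eq0; move: (lead_coef f) => a a0; rewrite -mul_polyC poly_inM.
have an0 : poly_in L a%:P != 0 by rewrite poly_in_eq0 polyC_eq0.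
have rn0 s : poly_in L (\prod_(z <- s) ('X - z%:P)) != 0.
  by rewrite poly_in_eq0 monic_neq0 ?monic_prod_XsubC.
have val_a K (U : place K) : U (poly_in L a%:P) = 0 by apply: val_at_cst.
rewrite !val_atM ?poly_in_mem ?rn0 //  !val_a !add0r.
elim: r => [|c r IH]; first by rewrite big_nil poly_in1 !val1 mulr0.
by rewrite big_cons poly_inM !val_atM ?poly_in_mem ?lin_neq0 ?rn0 // mulrDr -IH -eqQV.
Qed.

Lemma val_mem1_lin E F (Q : place E) (V : place F) (e : int) :
    (forall c, Q (lin c) = e * V (lin c)) ->
  forall z, z \in 1%VS -> z != 0 -> Q z = e * V z.
Proof.
move=> /val_poly_lin eqQV z /mem1_fracE[[f g] /= g0 ->]; rewrite mulf_eq0 invr_eq0.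
rewrite !poly_in_eq0 => /norP[f0 _].
by rewrite !val_div ?poly_in_mem ?poly_in_eq0 // !eqQV // mulrBr.
Qed.

(** Two linear polynomials differ by a constant, of value 0.  Hence at most one of
    them has positive value, and a negative value is common to all of them.  They
    cannot all have value 0, or the place would be trivial on k(x). *)
Lemma place_mem1_cases E (Q : place E) :
  (exists2 c, 0 < Q (lin c) & forall c', c' != c -> Q (lin c') = 0) \/
  (exists2 n, 0 < n & forall c, Q (lin c) = - n).
Proof.
have shift c c' : Q (lin c) < 0 -> Q (lin c') = Q (lin c).
  move=> Qc; rewrite (linB c c').
  case: (@val_addr _ _ _ Q (lin c) (cst L (c - c'))) => //.
  - exact: lin_in.
  - by rewrite cstE poly_in_mem.
  - exact: lin_neq0.
  - by apply: (vge_le _ (vge_cst _ _)); rewrite lezD1.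
have [[c Qc]|] := pselect (exists c, 0 < Q (lin c)).
  left; exists c => // c' cc'; have cc0 : c - c' != 0 by rewrite subr_eq0 eq_sym.
  rewrite (linB c c') addrC.
  case: (@val_addr _ _ _ Q (cst L (c - c')) (lin c)) => [||||_ ->].
  - by rewrite cstE poly_in_mem.
  - exact: lin_in.
  - by rewrite cstE poly_in_eq0 polyC_eq0.
  - by rewrite val_at_cst // vgeE ?lin_neq0 // lezD1.
  - exact: val_at_cst.
move=> npos; have [[c Qc]|nneg] := pselect (exists c, Q (lin c) < 0).
  by right; exists (- Q (lin c)) => [|c']; rewrite ?oppr_gt0 ?opprK //; apply: shift.
have Qlin c : Q (lin c) = 0 * Q (lin c).
  rewrite mul0r; have [Q0|Q0|//] := ltrgtP (Q (lin c)) 0.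
    by case: nneg; exists c.
  by case: npos; exists c.
have [z [z1 z0 Qz]] := place_nontrivial Q (sub1v E).
by move: Qz; rewrite (val_mem1_lin Qlin) // mul0r eqxx.
Qed.

(** The places of k(x) are the points of the projective line: the first case is
    the point [c], the second one is infinity, and [n] is the ramification index
    of [Q] over it. *)
Lemma place_mem1 E (Q : place E) : exists2 n : int, 0 < n &
  (exists c, forall f, f != 0 -> Q (poly_in L f) = n * (mup c f)%:Z) \/
  (forall f, f != 0 -> Q (poly_in L f) = n * (1 - (size f)%:Z)).
Proof.
have [[c Qc Qc']|[n n0 Qn]] := place_mem1_cases Q; [exists (Q (lin c))|exists n] => //.
  left; exists c => f f0; have [V VE] := place_at L c; rewrite -VE //.
  apply: val_poly_lin => // c'; rewrite VE ?polyXsubC_eq0 // -['X - _]expr1 mup_XsubCX.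
  by have [->|cc'] := eqVneq c' c; rewrite ?mulr1 ?mulr0 //; apply: Qc'.
right=> f f0; have [V VE] := place_infty L; rewrite -VE //.
apply: val_poly_lin => // c; rewrite Qn VE ?polyXsubC_eq0 // size_XsubC; lia.
Qed.

(** A root of the denominator in lowest terms would be a pole, and infinity would
    be one if the numerator were then not constant. *)
Lemma mem1_no_pole z : z \in 1%VS ->
  (forall Q : place (1%AS : {subfield L}), vge Q 0 z) -> exists c, z = cst L c.
Proof.
move=> z1; have [->|z0] := eqVneq z 0; first by exists 0; rewrite cstE !rmorph0.
have [f [g [g0 cop zE]]] := mem1_coprimeE z1; move=> Qz.
have f0 : f != 0 by apply: contraNneq z0 => f0; rewrite zE f0 rmorph0 mul0r.
have sg : size g = 1%N.
  apply: contrapT => /eqP/(alg_closed_root kcl)[c gc]; have [V VE] := place_at L c.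
  have fc : ~~ root f c by apply: (coprimep_root _ gc); rewrite coprimep_sym.
  have mg : (0 < mup c g)%N by rewrite mup_geq // expr1 dvdp_XsubCl.
  have := Qz V; rewrite vgeE // zE val_div ?poly_in_mem ?poly_in_eq0 // !VE //.
  by rewrite mupNroot // sub0r oppr_ge0 lez_nat leqNgt mg.
have sf : (size f <= 1)%N.
  have [V VE] := place_infty L; have := Qz V.
  rewrite vgeE // zE val_div ?poly_in_mem ?poly_in_eq0 // !VE // sg; lia.
exists (f`_0 / g`_0); rewrite zE (size1_polyC sf) (@size1_polyC _ g) ?sg //.
by rewrite !coefC /= -!cstE fmorph_div.
Qed.

End ClosedConstants.

(** * Residue fields *)

Section Residues.
Variables (k : fieldType) (L : fieldExtType (ratfun k)) (kcl : alg_closed k).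
Implicit Types (E F : {subfield L}).

(** A uniformizer has value 1, which is a multiple of [n]. *)
Lemma place1_unit (Q : place (1%AS : {subfield L})) (n : int) (mu : {poly k} -> int) :
  0 < n -> (forall f, f != 0 -> Q (poly_in L f) = n * mu f) -> n = 1.
Proof.
move=> n0 Qn; have [t [t1 t0 Qt]] := uniformizerE Q.
have [[f g] /= g0 tE] := mem1_fracE t1.
have f0 : f != 0 by apply: contraNneq t0 => f0; rewrite tE f0 poly_in0 mul0r.
move: Qt; rewrite tE val_div ?poly_in_mem ?poly_in_eq0 // !Qn // -mulrBr.
move: (mu f - mu g) => a na; have a0 : 0 < a by rewrite -(pmulr_rgt0 _ n0) na.
by clear -n0 a0 na; nia.
Qed.

Lemma place1_eq (Q Q' : place (1%AS : {subfield L})) (n n' : int) (mu : {poly k} -> int) :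
    0 < n -> 0 < n' -> (forall f, f != 0 -> Q (poly_in L f) = n * mu f) ->
    (forall f, f != 0 -> Q' (poly_in L f) = n' * mu f) ->
  Q = Q'.
Proof.
move=> n0 n0' Qn Qn'; apply: place_eq => z z1 z0.
have n1 := place1_unit n0 Qn; have n1' := place1_unit n0' Qn'; subst n n'.
rewrite -[RHS]mul1r; apply: (val_mem1_lin kcl _ z1 z0) => c.
by rewrite mul1r Qn ?Qn' ?polyXsubC_eq0.
Qed.

(** The function is the inverse of [x - c] at the point [c], and [x] at
    infinity. *)
Lemma mem1_simple_pole (P : place (1%AS : {subfield L})) : exists t,
  [/\ t \in 1%VS, t != 0, P t = -1 & forall Q : place (1%AS : {subfield L}), Q <> P -> 0 <= Q t].
Proof.
have [n n0 [[c Pc]|Pinf]] := place_mem1 kcl P.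
  have n1 := place1_unit n0 Pc; exists (lin L c)^-1.
  have mup1 : mup c ('X - c%:P) = 1%N by rewrite -['X - _]expr1 mup_XsubCX eqxx.
  split; rewrite ?rpredV ?lin_in ?invr_eq0 ?lin_neq0 ?valV ?lin_in //.
    by rewrite Pc ?polyXsubC_eq0 // mup1 n1.
  move=> Q nQP; rewrite valV ?lin_in // oppr_ge0.
  have [n' n0' [[c' Qc']|Qinf]] := place_mem1 kcl Q.
    have [cc'|cc'] := eqVneq c' c; first by subst c'; case: nQP; apply: place1_eq Qc' Pc.
    by rewrite Qc' ?polyXsubC_eq0 // -['X - _]expr1 mup_XsubCX eq_sym (negPf cc') mulr0.
  by rewrite Qinf ?polyXsubC_eq0 // size_XsubC; nia.
have n1 := place1_unit n0 Pinf; exists (lin L 0).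
split; rewrite ?lin_in ?lin_neq0 //.
  by rewrite Pinf ?polyXsubC_eq0 // size_XsubC n1.
move=> Q nQP; have [n' n0' [[c' Qc']|Qinf]] := place_mem1 kcl Q.
  by rewrite Qc' ?polyXsubC_eq0 //; nia.
by case: nQP; apply: place1_eq Qinf Pinf.
Qed.

(** For [z = f / g] in lowest terms, the residue is [f.[a] / g.[a]] at the point
    [a].  At infinity it is the quotient of the coefficients of [f] and [g] in the
    degree of [g]. *)
Lemma residue_mem1 E (Q : place E) z : z \in 1%VS -> vge Q 0 z ->
  exists c, vge Q 1 (z - cst L c).
Proof.
move=> z1; have [->|z0] := eqVneq z 0.
  by exists 0; rewrite rmorph0 subrr vge0.
have [f [g [g0 cop zE]]] := mem1_coprimeE z1.
have f0 : f != 0 by apply: contraNneq z0 => f0; rewrite zE f0 poly_in0 mul0r.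
rewrite vgeE // {1}zE val_div ?poly_in_mem ?poly_in_eq0 // => Qz.
have step c : (f - c *: g != 0 -> Q (poly_in L g) < Q (poly_in L (f - c *: g))) ->
    vge Q 1 (z - cst L c).
  have -> : z - cst L c = poly_in L (f - c *: g) / poly_in L g.
    by rewrite -mul_polyC poly_inB poly_inM -cstE mulrBl -zE mulfK ?poly_in_eq0.
  have [->|h0] := eqVneq (f - c *: g) 0; first by rewrite poly_in0 mul0r vge0.
  move=> /(_ isT) lt_gh; rewrite vgeE ?val_div ?mulf_neq0 ?invr_eq0 ?poly_in_eq0 ?poly_in_mem //.
  by rewrite lerBrDr addrC lezD1.
have [n n0 [[a Qa]|Qinf]] := place_mem1 kcl Q.
  have root_mup h : h != 0 -> root h a -> (0 < mup a h)%N.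
    by move=> h0 ha; rewrite mup_geq // expr1 dvdp_XsubCl.
  have ga : g.[a] != 0.
    apply/negP => /eqP/rootP ga; have fa : ~~ root f a.
      by apply: (coprimep_root _ ga); rewrite coprimep_sym.
    move: Qz; rewrite !Qa // (mupNroot fa); have := root_mup g g0 ga.
    by move: (mup _ _) => u; nia.
  exists (f.[a] / g.[a]); apply: step => h0; rewrite !Qa // (mupNroot ga) mulr0.
  rewrite mulr_gt0 // ltz_nat root_mup // /root hornerD hornerN hornerZ.
  by rewrite divfK // subrr.
exists (f`_(size g).-1 / lead_coef g); apply: step => h0; rewrite !Qinf //.
move: Qz; rewrite !Qinf // => Qz.
have sg : (0 < size g)%N by rewrite size_poly_gt0.
have sfg : (size f <= size g)%N by move: (size f) (size g) Qz => u v; nia.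
suff sh : (size (f - (f`_(size g).-1 / lead_coef g) *: g)%R < size g)%N.
  by rewrite ltr_pM2l // ltrBrDl; lia.
rewrite -(prednK sg) ltnS; apply/leq_sizeP => j.
rewrite leq_eqVlt coefB coefZ => /predU1P[<-|lt_j].
  by rewrite -/(lead_coef g) divfK ?lead_coef_eq0 // subrr.
have le_j : (size g <= j)%N by lia.
by rewrite (nth_default _ le_j) (nth_default _ (leq_trans sfg le_j)) mulr0 subrr.
Qed.

(** The polynomial [eta] splits, and a product of integral elements has positive
    value only if one of its factors has. *)
Lemma residue_root E (Q : place E) (eta : {poly k}) z :
    eta != 0 -> z \in E -> vge Q 0 z -> vge Q 1 (map_poly (cst L) eta).[z] ->
  exists2 c, root eta c & vge Q 1 (z - cst L c).
Proof.
have [r etaE] := kcl eta.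
move=> eta0 Ez z0; move: (eta0); rewrite -lead_coef_eq0 => lc0.
suff : vge Q 1 (cst L (lead_coef eta) * \prod_(c <- r) (z - cst L c)) ->
    exists2 c, c \in r & vge Q 1 (z - cst L c).
  rewrite {2}etaE map_polyZ hornerZ rmorph_prod horner_prod => H zr.
  have [|c rc zc] := H; last first.
    by exists c => //; rewrite etaE rootZ // root_prod_XsubC.
  congr (vge Q 1 (_ * _)): zr; apply: eq_bigr => c _.
  by rewrite rmorphB /= map_polyX map_polyC hornerXsubC.
move: (lead_coef eta) lc0 => a a0 {eta0 etaE}.
have Eprod s : \prod_(c <- s) (z - cst L c) \in E.
  by apply: rpred_prod => c _; rewrite rpredB ?cst_mem.
elim: r => [|c r IH]; first by rewrite big_nil mulr1 vgeE ?cst_eq0 // val_at_cst.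
rewrite big_cons mulrCA => zr.
have [zc|nzc] := boolP (vge Q 1 (z - cst L c)).
  by exists c; rewrite ?mem_head.
have zc0 : z - cst L c != 0 by apply: contraNneq nzc => ->; apply: vge0.
have Qzc : Q (z - cst L c) = 0.
  have : vge Q 0 (z - cst L c) by rewrite vgeB ?cst_mem ?vge_cst.
  by move: nzc; rewrite !vgeE //; move: (Q _) => q; lia.
have [|c' rc' zc'] := IH; last by exists c'; rewrite // inE rc' orbT.
have [->|p0] := eqVneq (cst L a * \prod_(c0 <- r) (z - cst L c0)) 0; first exact: vge0.
have zp0 := mulf_neq0 zc0 p0.
move: zr; rewrite !vgeE // val_atM ?Qzc ?add0r //.
  by rewrite rpredB ?cst_mem.
by rewrite rpredM ?cst_mem.
Qed.

Lemma poly_residue E (Q : place E) (H : {poly L}) :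
    (forall i, exists c, vge Q 1 (H`_i - cst L c)) ->
  exists2 eta : {poly k}, (size eta <= size H)%N &
    forall i, vge Q 1 (H`_i - cst L eta`_i).
Proof.
move=> /boolp.choice[e eP]; exists (\poly_(i < size H) e i); first exact: size_poly.
move=> i; rewrite coef_poly; case: ltnP => // le_i.
by rewrite nth_default // rmorph0 subrr vge0.
Qed.

Lemma poly_residue_horner E (Q : place E) (H : {poly L}) (eta : {poly k}) z :
    H \is a polyOver E -> z \in E -> vge Q 0 z ->
    (forall i, vge Q 1 (H`_i - cst L eta`_i)) ->
  vge Q 1 (H.[z] - (map_poly (cst L) eta).[z]).
Proof.
move=> EH Ez z0 Heta; rewrite -hornerN -hornerD vge_horner //.
  by rewrite rpredB //; apply/polyOverP => i; rewrite coef_map cst_mem.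
by move=> i; rewrite coefB coef_map; apply: Heta.
Qed.

(** Every residue is a constant.  The minimal polynomial of [z] over k(x), divided
    by a coefficient of least value, reduces to a nonzero polynomial over the
    constants, because the residues of rational functions are constants; the
    reduction vanishes at the residue of [z]. *)
Lemma residue E (Q : place E) z : z \in E -> vge Q 0 z ->
  exists c, vge Q 1 (z - cst L c).
Proof.
move=> Ez z0; set M := minPoly 1 z.
have M1 i : M`_i \in (1%AS : {subfield L}) by apply/polyOverP/minPolyOver.
have EM i : M`_i \in E by apply: (subvP (sub1v E)).
have M0 : M != 0 by rewrite monic_neq0 ?monic_minPoly.
have [i ci min_i] := ex_min_coef Q M0.
have EH : (M`_i)^-1 *: M \is a polyOver E.
  by apply/polyOverP => j; rewrite coefZ rpredM ?rpredV.
have [|eta _ etaE] := @poly_residue _ Q ((M`_i)^-1 *: M).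
  move=> j; apply: residue_mem1; rewrite coefZ.
    have : (M`_i)^-1 * M`_j \in (1%AS : {subfield L}) by rewrite rpredM ?rpredV.
    by [].
  by have := vge_div (EM j) (EM i) ci (min_i j); rewrite subrr mulrC.
(* The coefficient of index [i] has been scaled to 1. *)
have eta0 : eta != 0.
  apply: contraTneq (etaE i) => ->; rewrite coefZ mulVf // coef0 rmorph0 subr0.
  by rewrite vgeE ?oner_eq0 // val1.
have [|c _ zc] := residue_root eta0 Ez z0; last by exists c.
have := poly_residue_horner EH Ez z0 etaE.
rewrite hornerZ (rootP (root_minPoly _ _)) mulr0 sub0r vgeN //.
by apply: rpred_horner => //; apply/polyOverP => j; rewrite coef_map cst_mem.
Qed.

End Residues.

(** * Split places of an Artin-Schreier extension *)

Section Close.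
Variables (k : fieldType) (L : fieldExtType (ratfun k)).
Variables (E : {subfield L}) (Q : place E).

Lemma vge_exp n i z : z \in E -> vge Q n z -> vge Q (i%:Z * n) (z ^+ i).
Proof.
move=> Ez nz; elim: i => [|i IH]; first by rewrite mul0r vge1.
by rewrite exprS intS mulrDl mul1r vgeM ?rpredX.
Qed.

Lemma vge_subX n i a b : a \in E -> b \in E -> vge Q 0 a -> vge Q 0 b ->
  vge Q n (a - b) -> vge Q n (a ^+ i - b ^+ i).
Proof.
move=> Ea Eb a0 b0 nab; elim: i => [|i IH]; first by rewrite subrr vge0.
have -> : a ^+ i.+1 - b ^+ i.+1 = a * (a ^+ i - b ^+ i) + (a - b) * b ^+ i.
  by rewrite mulrBr mulrBl -!exprS addrA subrK.
have EX c j : c \in E -> c ^+ j \in E by apply: rpredX.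
rewrite vgeD ?rpredM ?rpredB ?EX //; first by rewrite -[n]add0r vgeM ?rpredB ?EX.
by rewrite -[n]addr0 vgeM ?rpredB ?EX ?vge0X.
Qed.

Lemma vge_sub_horner n c (G : {poly L}) a b : G \is a polyOver E ->
    (forall i, vge Q c G`_i) -> a \in E -> b \in E -> vge Q 0 a -> vge Q 0 b ->
  vge Q n (a - b) -> vge Q (c + n) (G.[a] - G.[b]).
Proof.
move=> /polyOverP EG cG Ea Eb a0 b0 nab; rewrite !horner_coef -sumrB vge_sum // => i _.
  by apply: rpredB; apply: rpredM; rewrite ?rpredX ?EG.
by rewrite -mulrBr; apply: vgeM; rewrite ?vge_subX // ?rpredB ?rpredX ?EG.
Qed.

Lemma coef_bound (G : {poly L}) : exists c : int, forall i, vge Q c G`_i.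
Proof.
have [->|/(ex_min_coef Q)[i _ min_i]] := eqVneq G 0.
  by exists 0 => i; rewrite coef0 vge0.
by exists (Q G`_i).
Qed.

End Close.

Section ArtinSchreier.
Variables (k : fieldType) (p : nat) (hp : p \in [pchar k]).
Variables (L : fieldExtType (ratfun k)) (K : {subfield L}) (y B : L).
Hypothesis (dimE : \dim_K <<K; y>> = p) (yB : y ^+ p - y = B) (KB : B \in K).
Let E := <<K; y>>%AS.

Lemma pcharL : p \in [pchar L].
Proof. exact: (rmorph_pchar (cst L) hp). Qed.

Lemma p_gt1 : (1 < p)%N.
Proof. exact/prime_gt1/(pcharf_prime hp). Qed.

Definition AS_poly := 'X^p - 'X - B%:P : {poly L}.

Lemma AS_polyE a : AS_poly.[a] = a ^+ p - a - B.
Proof. by rewrite !hornerE. Qed.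

Lemma size_AS_poly : size AS_poly = p.+1.
Proof.
rewrite /AS_poly -addrA size_polyDl ?size_polyXn //.
rewrite -opprD size_polyN size_XaddC; exact: p_gt1.
Qed.

Lemma AS_poly_monic : AS_poly \is monic.
Proof.
rewrite monicE /lead_coef size_AS_poly /= !coefB coefXn coefX coefC eqxx.
by have := p_gt1; case: p => [|[|n]] //; rewrite !subr0.
Qed.

(** The minimal polynomial divides [AS_poly] and has the same degree [p]. *)
Lemma AS_minPoly : minPoly K y = AS_poly.
Proof.
apply/eqP; rewrite -eqp_monic ?monic_minPoly ?AS_poly_monic //.
rewrite -dvdp_size_eqp; last first.
  apply: minPoly_dvdp; last by rewrite /root AS_polyE yB subrr.
  by rewrite !rpredB ?polyOverX ?polyOverXn ?polyOverC.
by rewrite size_minPoly size_AS_poly adjoin_degreeE dimE.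
Qed.

Lemma y_notin : y \notin K.
Proof.
apply/negP => Ky; have := dimE; rewrite (Fadjoin_idP Ky) divnn adim_gt0.
by move=> p1; have := p_gt1; rewrite -p1.
Qed.

Variable v : place K.
Variable a : L.
Hypothesis (Ka : a \in K) (a0 : vge v 0 a) (B0 : vge v 0 B)
  (aB : vge v 1 (a ^+ p - a - B)).

(** This is the Newton iteration for [AS_poly], the derivative of which is -1: the
    next approximation is [b + AS_poly.[b]]. *)
Definition approx n := iter n (fun b => b ^+ p - B) a.

Lemma approx_mem n : approx n \in K.
Proof. by elim: n => //= n IH; rewrite rpredB ?rpredX. Qed.

Lemma approx_ge0 n : vge v 0 (approx n).
Proof. by elim: n => //= n IH; rewrite vgeB ?vge0X ?rpredX ?approx_mem. Qed.

(** As the Frobenius map is additive, each step raises the defect to the power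
    [p]. *)
Lemma approx_defect n : vge v n.+1%:Z AS_poly.[approx n].
Proof.
rewrite AS_polyE; elim: n => //= n IH; set b := approx n in IH *.
have Kb : b \in K := approx_mem n.
set d := b ^+ p - b - B in IH *.
have -> : b ^+ p - B = b + d by rewrite /d; ring.
have -> : (b + d) ^+ p - (b + d) - B = d ^+ p.
  have := pFrobenius_autD_comm pcharL (mulrC b d); rewrite !pFrobenius_autE => ->.
  by rewrite /d; ring.
have Kd : d \in K by rewrite !rpredB ?rpredX.
apply: (vge_le _ (vge_exp p Kd IH)); have := p_gt1; clear; nia.
Qed.

Lemma approx_step n : vge v n.+1%:Z (approx n.+1 - approx n).
Proof. by have := approx_defect n; rewrite AS_polyE /= addrAC. Qed.

Lemma approx_close n : vge v 1 (approx n - a).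
Proof.
elim: n => [|n IH]; first by rewrite subrr vge0.
have -> : approx n.+1 - a = (approx n.+1 - approx n) + (approx n - a).
  by rewrite addrA subrK.
apply: vgeD => //; last by apply: (vge_le _ (approx_step n)).
  by apply: rpredB; apply: approx_mem.
by apply: rpredB; first apply: approx_mem.
Qed.

(** The approximations converge to a root of [AS_poly] in the completion of [K],
    and sending [y] to this root embeds [<<K; y>>] into the completion.  Up to an
    error tending to 0, [phi n f] is the image of [f]. *)
Definition phi n f := (Fadjoin_poly K y f).[approx n].

Lemma phi_mem n f : phi n f \in K.
Proof. by rewrite rpred_horner ?approx_mem ?Fadjoin_polyOver. Qed.

Lemma phiD n f g : phi n (f + g) = phi n f + phi n g.
Proof. by rewrite /phi raddfD hornerD. Qed.

Lemma phi_base n c : c \in K -> phi n c = c.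
Proof. by move=> Kc; rewrite /phi Fadjoin_polyC // hornerC. Qed.

(** Such a [G] is a multiple of [AS_poly], whose values at the approximations tend
    to 0. *)
Lemma root_approx (G : {poly L}) : G \is a polyOver K -> root G y ->
  exists c : int, forall n, vge v (n%:Z + c) G.[approx n].
Proof.
move=> KG Gy; have AG : AS_poly %| G by rewrite -AS_minPoly minPoly_dvdp.
have KA : AS_poly \is a polyOver K by rewrite -AS_minPoly minPolyOver.
have KR : G %/ AS_poly \is a polyOver K by apply: divp_polyOver.
have [c cR] := coef_bound v (G %/ AS_poly); exists c => n.
rewrite -(divpK AG) hornerM addrC.
apply: vgeM; rewrite ?rpred_horner ?approx_mem //.
  by apply: vge_horner; rewrite ?approx_mem ?approx_ge0.
by apply: (vge_le _ (approx_defect n)); rewrite lez_nat.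
Qed.

(** Multiplicativity of [phi n] fails by the reduction modulo the minimal
    polynomial of [y], which matters less and less. *)
Lemma phiM f g : f \in E -> g \in E ->
  exists c : int, forall n, vge v (n%:Z + c) (phi n (f * g) - phi n f * phi n g).
Proof.
move=> Ef Eg.
have [||c cP] := @root_approx (Fadjoin_poly K y (f * g) - Fadjoin_poly K y f * Fadjoin_poly K y g).
- by rewrite rpredB ?rpredM ?Fadjoin_polyOver.
- by rewrite /root hornerD hornerN hornerM !Fadjoin_poly_eq ?rpredM ?subrr.
by exists c => n; have := cP n; rewrite hornerD hornerN hornerM.
Qed.

Lemma phi_ge f : exists c : int, forall n, vge v c (phi n f).
Proof.
have [c cP] := coef_bound v (Fadjoin_poly K y f); exists c => n.
by apply: vge_horner; rewrite ?Fadjoin_polyOver ?approx_mem ?approx_ge0.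
Qed.

Lemma phi_step f : exists c : int, forall n, vge v (n%:Z + c) (phi n.+1 f - phi n f).
Proof.
have [c cP] := coef_bound v (Fadjoin_poly K y f); exists c => n.
rewrite addrC; apply: vge_sub_horner; rewrite ?Fadjoin_polyOver ?approx_mem ?approx_ge0 //.
by apply: (vge_le _ (approx_step n)); rewrite lez_nat.
Qed.

Definition lim_val f (w : int) :=
  exists N : nat, forall n, (N <= n)%N -> phi n f != 0 /\ v (phi n f) = w.

Lemma lim_val_unique f w w' : lim_val f w -> lim_val f w' -> w = w'.
Proof.
move=> [N NP] [N' NP']; have [_ <-] := NP _ (leq_maxl N N').
by have [_ <-] := NP' _ (leq_maxr N N').
Qed.

Lemma lim_val_close f w (s : nat -> L) (c : int) : lim_val f w ->
    (forall n, s n \in K) -> (forall n, vge v (n%:Z + c) (s n - phi n f)) ->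
  exists N : nat, forall n, (N <= n)%N -> s n != 0 /\ v (s n) = w.
Proof.
move=> [N NP] Ks cs; exists (maxn N (`|w - c|.+1)) => n.
rewrite geq_max => /andP[/NP[phi0 phiw] le_n].
rewrite -[s n](subrK (phi n f)) addrC -phiw.
apply: val_addr => //; [exact: phi_mem | by apply: rpredB; rewrite ?phi_mem ?Ks | ].
by apply: (vge_le _ (cs n)); rewrite phiw; move: le_n; clear; lia.
Qed.

(** Since [phi n f * phi n f^-1] is close to 1, the values of [phi n f] are
    bounded, while the successive differences tend to 0. *)
Lemma lim_val_exists f : f \in E -> f != 0 -> exists w, lim_val f w.
Proof.
move=> Ef f0; have EVf : f^-1 \in E by rewrite rpredV.
have [c cP] := phiM Ef EVf; have [c' cP'] := phi_ge f^-1; have [c'' cP''] := phi_step f.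
pose N := (`|c| + `|c'| + `|c''|).+1%N.
have bnd n : (N <= n)%N -> phi n f != 0 /\ v (phi n f) <= - c'.
  move=> le_n; have := cP n; rewrite divff // phi_base ?rpred1 // => close.
  have [] : 1 + - (1 - phi n f * phi n f^-1) != 0 /\
            v (1 + - (1 - phi n f * phi n f^-1)) = v 1.
    apply: val_addr; rewrite ?rpredN ?rpredB ?rpred1 ?rpredM ?phi_mem ?oner_eq0 //.
    rewrite vgeN ?rpredB ?rpred1 ?rpredM ?phi_mem // val1.
    by apply: (vge_le _ close); move: le_n; rewrite /N; clear; lia.
  rewrite opprB addrC subrK mulf_eq0 => /norP[nf0 nVf0].
  rewrite val_atM ?phi_mem // val1 => /eqP; rewrite addr_eq0 => /eqP ->.
  by split=> //; rewrite lerN2; have := cP' n; rewrite vgeE.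
exists (v (phi N f)), N => n le_n; split; first by have [] := bnd n le_n.
elim: n le_n => [|n IH]; first by rewrite leqn0 => /eqP <-.
rewrite leq_eqVlt => /predU1P[<- //|]; rewrite ltnS => le_n.
have [nf0 le_v] := bnd n le_n; rewrite -(IH le_n).
rewrite -[phi n.+1 f](subrK (phi n f)) addrC.
have [||||//] := @val_addr _ _ _ v (phi n f) (phi n.+1 f - phi n f).
- exact: phi_mem.
- by rewrite rpredB ?phi_mem.
- by [].
by apply: (vge_le _ (cP'' n)); move: le_n le_v; rewrite /N; clear; move: (v _) => u; lia.
Qed.

(** The place is induced by the valuation of the completion of [K] through the
    embedding that [phi] approximates. *)
Lemma AS_split_place : exists2 w : place E, ram_index v w 1 & vge w 1 (y - a).
Proof.
have KE : (K <= E)%VS by apply: subv_adjoin.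
have Ey : y \in E by apply: memv_adjoin.
have yK := y_notin.
have /boolp.choice[w wP] : forall f, exists n : int,
    (~~ ((f \in E) && (f != 0)) -> n = 0) /\ (f \in E -> f != 0 -> lim_val f n).
  move=> f; have [/andP[Ef f0]|out] := boolP ((f \in E) && (f != 0)).
    by have [n nP] := lim_val_exists Ef f0; exists n.
  by exists 0; split=> // Ef f0; rewrite Ef f0 in out.
have w1 z : ~~ ((z \in E) && (z != 0)) -> w z = 0 by apply: (wP z).1.
have w2 f g : f \in E -> g \in E -> f != 0 -> g != 0 -> w (f * g) = w f + w g.
  move=> Ef Eg f0 g0; have fg0 := mulf_neq0 f0 g0.
  have [c cP] := phiM Ef Eg.
  have [||N NP] := @lim_val_close (f * g) _ (fun n => phi n f * phi n g) c
                      ((wP _).2 (rpredM Ef Eg) fg0).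
  - by move=> n; rewrite rpredM ?phi_mem.
  - move=> n; rewrite -opprB vgeN; first exact: cP.
    by apply: rpredB; rewrite ?rpredM ?phi_mem.
  have [Nf NfP] := (wP f).2 Ef f0; have [Ng NgP] := (wP g).2 Eg g0.
  pose n := maxn N (maxn Nf Ng).
  have [|_ <-] := NP n; first by rewrite leq_maxl.
  have [|nf0 <-] := NfP n; first by rewrite !leq_max leqnn ?orbT.
  have [|ng0 <-] := NgP n; first by rewrite !leq_max leqnn ?orbT.
  by rewrite val_atM ?phi_mem.
have w3 f g : f \in E -> g \in E -> f != 0 -> g != 0 -> f + g != 0 ->
    Num.min (w f) (w g) <= w (f + g).
  move=> Ef Eg f0 g0 fg0; have [N NP] := (wP _).2 (rpredD Ef Eg) fg0.
  have [Nf NfP] := (wP f).2 Ef f0; have [Ng NgP] := (wP g).2 Eg g0.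
  pose n := maxn N (maxn Nf Ng).
  have [|nfg0 <-] := NP n; first by rewrite leq_maxl.
  have [|nf0 <-] := NfP n; first by rewrite !leq_max leqnn ?orbT.
  have [|ng0 <-] := NgP n; first by rewrite !leq_max leqnn ?orbT.
  by rewrite phiD in nfg0 *; apply: val_atD; rewrite ?phi_mem.
have wv z : z \in K -> z != 0 -> w z = v z.
  move=> Kz z0; apply: lim_val_unique ((wP z).2 _ z0) _; first exact: (subvP KE).
  by exists 0%N => n _; rewrite phi_base.
have w4 (c : k) : c != 0 -> w (cst L c) = 0.
  by move=> c0; rewrite wv ?cst_mem ?cst_eq0 // val_at_cst.
have w5 : exists2 t, t \in E & w t = 1.
  have [t [Kt t0 vt]] := uniformizerE v.
  by exists t; rewrite ?wv //; apply: (subvP KE).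
exists (Place w1 w2 w3 w4 w5); first by split=> // z Kz z0; rewrite mul1r -wv.
rewrite vgeE /=; last by apply: contraNneq yK => /eqP; rewrite subr_eq0 => /eqP->.
have ya0 : y - a != 0 by apply: contraNneq yK => /eqP; rewrite subr_eq0 => /eqP->.
have Eya : y - a \in E by rewrite rpredB ?(subvP KE a Ka).
have [N NP] := (wP _).2 Eya ya0; have [n0 <-] := NP N (leqnn _).
move: n0; rewrite phiD (@phi_base N (- a)) ?rpredN // /phi Fadjoin_polyX // hornerX => n0.
by have := approx_close N; rewrite vgeE.
Qed.

End ArtinSchreier.

Section ArtinSchreierIntegral.
Variables (k : fieldType) (kcl : alg_closed k) (p : nat) (hp : p \in [pchar k]).
Variables (L : fieldExtType (ratfun k)) (K : {subfield L}) (y B : L).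
Hypothesis (dimE : \dim_K <<K; y>> = p) (yB : y ^+ p - y = B) (KB : B \in K).

Lemma vge_ram1 (E : {subfield L}) (v : place K) (w : place E) n z :
  ram_index v w 1 -> z \in K -> vge w n z = vge v n z.
Proof. by case=> _ wv Kz; rewrite /vge; case: eqP => //= /eqP z0; rewrite wv // mul1r. Qed.

(** The solutions are the translates of one of them by the prime field. *)
Lemma AS_roots (beta : k) : exists2 s : seq k, uniq s /\ size s = p &
  forall c, c \in s -> c ^+ p - c = beta.
Proof.
have p1 := p_gt1 hp.
have [c /rootP] : exists c, root ('X^p - 'X - beta%:P) c.
  apply: alg_closed_root => //; rewrite -addrA size_polyDl ?size_polyXn; first by lia.
  by rewrite -opprD size_polyN size_XaddC.
rewrite !hornerE => /eqP; rewrite subr_eq0 => /eqP cE.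
exists [seq c + i%:R | i <- iota 0 p]; first split.
- rewrite map_inj_in_uniq ?iota_uniq // => i j; rewrite !mem_iota /= => ip jp /addrI.
  wlog le_ij : i j ip jp / (i <= j)%N.
    by move=> H ij; case: (leqP i j) => [|/ltnW] /H ->.
  move=> /esym/eqP; rewrite -subr_eq0 -natrB // -(dvdn_pcharf hp) => /dvdnP[q].
  by move: ip jp le_ij; clear; case: q => [|q]; rewrite ?mul0n ?mulSn; lia.
- by rewrite size_map size_iota.
move=> _ /mapP[i _ ->].
have := pFrobenius_autD_comm hp (mulrC c i%:R); rewrite !pFrobenius_autE => ->.
have := pFrobenius_aut_nat hp i; rewrite pFrobenius_autE => ->.
by rewrite -cE; ring.
Qed.

(** A negative coefficient would, after scaling, leave a nonzero residue
    polynomial of degree less than [p] that vanishes at the [p] residues of [y]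
    given by the [p] places over [v]. *)
Lemma AS_integral (v : place K) (G : {poly L}) :
    vge v 0 B -> G \is a polyOver K -> (size G <= p)%N ->
    (forall w : place <<K; y>>%AS, ram_index v w 1 -> vge w 0 G.[y]) ->
  forall i, vge v 0 G`_i.
Proof.
move=> B0 KG sG wG j; apply: contrapT => /negP nGj.
have Kc i : G`_i \in K by move/polyOverP: KG.
have G0 : G != 0 by apply: contraNneq nGj => ->; rewrite coef0 vge0.
have [i ci min_i] := ex_min_coef v G0.
have vi : v G`_i < 0.
  rewrite ltNge; apply: contra nGj => vi; exact: (vge_le vi (min_i j)).
pose H := (G`_i)^-1 *: G.
have KHc l : H`_l \in K by rewrite coefZ rpredM ?rpredV.
have KH : H \is a polyOver K by apply/polyOverP.
have H0 l : vge v 0 H`_l.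
  by have := vge_div (Kc l) (Kc i) ci (min_i l); rewrite subrr mulrC coefZ.
have [|eta seta etaE] := @poly_residue _ _ _ v H.
  by move=> l; apply: residue kcl _ _ _ (KHc l) (H0 l).
have [beta Bbeta] := residue kcl KB B0.
have [s [us ss] sP] := AS_roots beta.
(* The coefficient of index [i] has been scaled to 1. *)
suff eta0 : eta = 0.
  have := etaE i; rewrite eta0 coefZ mulVf // coef0 rmorph0 subr0.
  by rewrite vgeE ?oner_eq0 // val1.
apply: contraTeq seta => eta0; rewrite -ltnNge size_scale ?invr_eq0 //.
apply: leq_ltn_trans sG _; rewrite -ss; apply: max_poly_roots => //.
apply/allP => c /sP cE.
have KcL : cst L c \in K by apply: cst_mem.
have [|w vw wyc] := @AS_split_place _ _ hp _ _ _ _ dimE yB KB v (cst L c) KcL (vge_cst v c) B0.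
  rewrite -rmorphXn -rmorphB cE -opprB vgeN ?rpredB ?cst_mem //.
have KE : (K <= <<K; y>>)%VS by apply: subv_adjoin.
have Ey : y \in <<K; y>>%AS by apply: memv_adjoin.
have EH : H \is a polyOver <<K; y>>%AS by apply: polyOverS KH; apply: subvP.
have wc0 : vge w 0 (cst L c) by apply: vge_cst.
have wy0 : vge w 0 y.
  by have := vgeD (rpredB Ey (cst_mem _ c)) (cst_mem _ c) (vge_le _ wyc) wc0; rewrite subrK; apply.
have wHy : vge w 1 H.[y].
  rewrite /H hornerZ mulrC; have := vge_div (rpred_horner (polyOverS (subvP KE) KG) Ey)
    (subvP KE _ (Kc i)) ci (wG w vw).
  have -> : w G`_i = v G`_i by case: vw => _ vw; rewrite (vw _ (Kc i) ci) mul1r.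
  by apply: vge_le; move: vi; move: (v _) => u; clear; lia.
have wH0 l : vge w 0 H`_l by rewrite (vge_ram1 _ vw).
have wHc : vge w 1 H.[cst L c].
  rewrite -[H.[_]](subKr H.[y]) vgeB ?rpredB ?rpred_horner ?cst_mem //.
  by rewrite -[X in vge _ X]add0r; apply: vge_sub_horner; rewrite ?cst_mem.
have vHc : vge v 1 H.[cst L c] by rewrite -(vge_ram1 _ vw) ?rpred_horner.
have Ke : (map_poly (cst L) eta).[cst L c] \in K by rewrite horner_map cst_mem.
have KHcst := rpred_horner KH KcL.
have := vgeB KHcst (rpredB KHcst Ke) vHc (poly_residue_horner KH KcL (vge_cst v c) etaE).
rewrite subKr horner_map /=; apply: contraTT => ec.
by rewrite vgeE ?cst_eq0 // val_at_cst.
Qed.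
End ArtinSchreierIntegral.

(** * Places invariant under conjugation *)

Section Conjugates.
Variables (k : fieldType) (L : splittingFieldType (ratfun k)).
Variables (F M : {subfield L}) (v : place F) (W : place M).
Hypotheses (galF : galois F {: L}) (hM : forall z, z \in M) (vW : lies_over v W)
  (W_unique : forall W' : place M, lies_over v W' -> W' = W).

Lemma vge0_over (E : {subfield L}) (U : place E) z : z \in F -> lies_over v U ->
  vge U 0 z = vge v 0 z.
Proof.
move=> Fz [e [e0 vU]]; rewrite /vge; case: eqP => //= /eqP z0.
by rewrite vU // pmulr_rge0.
Qed.

(** Composed with a conjugation, [W] is again a place over [v]. *)
Lemma val_conj (s : gal_of {: L}) z : s \in ('Gal({: L} / F))%g -> W (s z) = W z.
Proof.
move=> Fs; have fixF c : c \in F -> s c = c by apply: fixed_gal Fs; apply: subvf.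
pose w c := W (s c).
have w1 c : ~~ ((c \in M) && (c != 0)) -> w c = 0.
  by rewrite hM negbK /w => /eqP->; rewrite rmorph0 val0.
have w2 c d : c \in M -> d \in M -> c != 0 -> d != 0 -> w (c * d) = w c + w d.
  by move=> _ _ c0 d0; rewrite /w rmorphM val_atM ?hM ?fmorph_eq0.
have w3 c d : c \in M -> d \in M -> c != 0 -> d != 0 -> c + d != 0 ->
    Num.min (w c) (w d) <= w (c + d).
  move=> _ _ c0 d0; rewrite -(fmorph_eq0 s) /w rmorphD => cd0.
  by rewrite rmorphD; apply: val_atD; rewrite ?hM ?fmorph_eq0.
have w4 c : c != 0 -> w (cst L c) = 0.
  by move=> c0; rewrite /w fixF ?cst_mem // val_at_cst.
have w5 : exists2 t, t \in M & w t = 1.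
  have [e [e0 We]] := vW; have [t [_ t0 Wt]] := uniformizerE W.
  exists ((s^-1)%g t); rewrite ?hM // /w.
  by rewrite -galM ?memvf // mulVg gal_id.
suff /(congr1 (fun Q : place M => val_at Q z)) : Place w1 w2 w3 w4 w5 = W by [].
apply: W_unique; have [e [e0 We]] := vW; exists e; split=> // c Fc c0 /=.
by rewrite /w fixF // We.
Qed.

(** All conjugates of [z] have the value of [z], so the coefficients of its
    minimal polynomial are integral. *)
Lemma vge0_transfer (E : {subfield L}) (U : place E) z : (F <= E)%VS ->
  lies_over v U -> z \in E -> vge W 0 z -> vge U 0 z.
Proof.
move=> FE vU Ez Wz; have FEs := subvP FE.
apply: (@vge0_root _ _ _ _ (minPoly F z)); rewrite ?monic_minPoly ?root_minPoly //.
  exact: polyOverS FEs _ (minPolyOver _ _).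
move=> i; have Fi : (minPoly F z)`_i \in F by move/polyOverP: (minPolyOver F z).
rewrite vge0_over // -(vge0_over Fi vW).
have [r [/fintype.subsetP rG _ ->]] := galois_factors (subvf F) galF z (memvf z).
have : all (fun b => vge W 0 b) [seq x z | x : gal_of {: L} <- r].
  apply/allP => _ /mapP[x rx ->]; rewrite /vge fmorph_eq0.
  by rewrite val_conj ?rG.
elim: [seq x z | x : gal_of {: L} <- r] i {Fi} => [|b s IH] i.
  by rewrite big_nil coef1; case: i => [|i] _; rewrite ?vge1 ?vge0.
rewrite big_cons mulrC => /andP[b0 /IH{}IH].
rewrite mulrBr coefB coefMX coefMC vgeB ?hM //; first by case: eqP; rewrite ?vge0.
by rewrite vge0M ?hM.
Qed.

(** A discrete valuation ring is maximal in its field of fractions: the hypothesis,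
    applied to the products [z ^ i * t ^ j] with [t] a uniformizer of [U], forces
    [W z = W t * U z]. *)
Lemma over_of_vge0 (E : {subfield L}) (U : place E) :
  (forall z, z \in E -> vge W 0 z -> vge U 0 z) -> lies_over U W.
Proof.
move=> WU; have [t [Et t0 Ut]] := uniformizerE U.
have key z i j : z \in E -> z != 0 -> 0 <= i * W z + j * W t -> 0 <= i * U z + j.
  move=> Ez z0 le0; have x0 : z ^ i * t ^ j != 0 by rewrite mulf_neq0 ?expfz_neq0.
  have Ex : z ^ i * t ^ j \in E by rewrite rpredM ?mem_exprz.
  have := WU _ Ex; rewrite !vgeE // !val_atM ?hM ?mem_exprz ?expfz_neq0 //.
  by rewrite !valXz ?hM // Ut mulr1; apply.
have Wt : 0 < W t.
  by rewrite ltNge; apply/negP => Wt; have := key t 0 (-1) Et t0; lia.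
exists `|W t|%N; split; first by lia.
move=> z Ez z0; have := key z (W t) (- W z) Ez z0; have := key z (- W t) (W z) Ez z0.
by rewrite gtz0_abs //; move: (W z) (U z) (W t) Wt; clear => *; nia.
Qed.

Lemma over_top (E : {subfield L}) (U : place E) : (F <= E)%VS ->
  lies_over v U -> lies_over U W.
Proof. by move=> FE vU; apply: over_of_vge0 => z; apply: vge0_transfer. Qed.

End Conjugates.

(** * The tower *)

Lemma ramification_semigroup_step p lam j a n : ramification_semigroup p lam j a ->
  ramification_semigroup p lam j.+1 (p * a + lam j.+1 * n)%N.
Proof.
case=> c ->; exists (fun l => if l == j.+1 then n else c l) => /=.
rewrite [in RHS]big_nat_recr //= eqxx subnn mul1n mulnDr mulnA -expnS addnA big_distrr /=.
congr (_ + _ + _)%N; apply: eq_big_nat => l /andP[_ lt_l].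
by rewrite ltn_eqF // subSn // expnS !mulnA.
Qed.

Lemma ramification_semigroupS p lam j a : ramification_semigroup p lam j.+1 a ->
  exists a' n, ramification_semigroup p lam j a' /\ a = (p * a' + lam j.+1 * n)%N.
Proof.
case=> c ->; exists (p ^ j * c 0 + \sum_(1 <= l < j.+1) p ^ (j - l) * lam l * c l)%N.
exists (c j.+1); split; first by exists c.
rewrite [in LHS]big_nat_recr //= subnn mul1n mulnDr mulnA -expnS addnA big_distrr /=.
congr (_ + _ + _)%N; apply: eq_big_nat => l /andP[_ lt_l].
by rewrite subSn // expnS !mulnA.
Qed.


Section Tower.
Variables (k : fieldType) (kcl : alg_closed k) (p : nat) (hp : p \in [pchar k])
  (L : splittingFieldType (ratfun k)) (m : nat)
  (hgal : galois 1%AS {: L}%AS)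
  (hdeg : \dim {: L}%AS = (p ^ m)%N)
  (T : nat -> {subfield L}) (hT : degree_p_tower p m T)
  (htot : forall Q : place (T 0%N), ramified (T m) Q -> totally_ramified (T m) Q)
  (s : nat) (P : 'I_s -> forall j, place (T j)) (hP : ramified_places m P)
  (y B : nat -> L) (lam : 'I_s -> nat -> nat)
  (hstd : standard_form p m P y B lam).

Lemma T0E : T 0%N = 1%AS. Proof. by case: hT. Qed.

Lemma top_mem z : z \in T m.
Proof. by case: hT => _ -> _; apply: memvf. Qed.

Lemma tower_step l : (l < m)%N -> (T l <= T l.+1)%VS.
Proof. by case: hT => _ _ H /H[]. Qed.

Lemma tower_sub l l' : (l <= l')%N -> (l' <= m)%N -> (T l <= T l')%VS.
Proof.
elim: l' => [|l' IH]; first by rewrite leqn0 => /eqP->.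
rewrite leq_eqVlt => /predU1P[-> //|]; rewrite ltnS => le_l lt_m.
exact: subv_trans (IH le_l (ltnW lt_m)) (tower_step lt_m).
Qed.

Lemma galois_tower l : galois (T l) {: L}%AS.
Proof. by apply: galoisS hgal; rewrite sub1v subvf. Qed.

Lemma P_lies_over i l : (l <= m)%N -> lies_over (P i 0%N) (P i l).
Proof. by case: hP => _ _; apply. Qed.

Lemma P_totally_ramified i : ram_index (P i 0%N) (P i m) (p ^ m) /\
  forall W : place (T m), lies_over (P i 0%N) W -> W = P i m.
Proof.
have [|Q [QP Q_unique]] := htot (Q := P i 0%N).
  by case: hP => _ ram _; apply/ram; exists i.
have QE := Q_unique _ (P_lies_over i (leqnn m)); split=> [|W /Q_unique->//].
suff dT : \dim_(T 0) (T m) = (p ^ m)%N by rewrite QE -dT.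
by rewrite T0E dimv1 divn1; case: hT => _ -> _; rewrite hdeg.
Qed.

Lemma P_below_top i l (U : place (T l)) : (l <= m)%N ->
  lies_over (P i 0%N) U -> lies_over U (P i m).
Proof.
move=> le_l; have [tot unique] := P_totally_ramified i.
apply: over_top (galois_tower 0) top_mem _ unique _ _ _; first by exists (p ^ m)%N.
exact: tower_sub.
Qed.

Lemma P_unique i l (U : place (T l)) : (l <= m)%N ->
  lies_over (P i 0%N) U -> U = P i l.
Proof.
move=> le_l /(P_below_top le_l)[e We]; have [e' We'] := P_below_top le_l (P_lies_over i le_l).
by case: (ram_index_inj We We').
Qed.

Lemma P_inj l i i' : (l <= m)%N -> P i l = P i' l -> i = i'.
Proof.
move=> le_l eqP; have [e Pe] := P_lies_over i le_l; have [e' Pe'] := P_lies_over i' le_l.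
rewrite eqP in Pe; have [eq0 _] := ram_index_inj Pe Pe'.
by case: hP => injP _ _; apply: injP.
Qed.

Lemma step_degree l : (l < m)%N -> \dim_(T l) <<T l; y l.+1>> = p.
Proof. by move=> lt_l; case: hT => _ _ /(_ l lt_l)[_]; have [-> _ _ _ _] := hstd lt_l. Qed.

Lemma step_equation l : (l < m)%N -> y l.+1 ^+ p - y l.+1 = B l.+1.
Proof. by move=> lt_l; have [_ -> _ _ _] := hstd lt_l. Qed.

Lemma B_mem l : (l < m)%N -> B l.+1 \in T l /\ B l.+1 != 0.
Proof. by move=> lt_l; have [_ _ [] ? ? _ _] := hstd lt_l. Qed.

Lemma y_mem l : (l < m)%N -> y l.+1 \in T l.+1.
Proof. by move=> lt_l; have [-> _ _ _ _] := hstd lt_l; apply: memv_adjoin. Qed.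

Lemma y_neq0 l : (l < m)%N -> y l.+1 != 0.
Proof.
move=> lt_l; have [_ B0] := B_mem lt_l; apply: contraNneq B0 => y0.
by rewrite -step_equation // y0 expr0n subr0; case: p (p_gt1 hp).
Qed.

Lemma B_regular l (Q : place (T l)) : (l < m)%N -> (forall i, Q <> P i l) -> 0 <= Q (B l.+1).
Proof.
move=> lt_l QP; have [_ _ _ [A [Binf [Apos _ _ divB]]] _] := hstd lt_l.
rewrite -divB coeffB raddf_sum big1 ?subr0 ?Apos // => i _ /=.
by rewrite coeffU; case: eqP => [/esym/QP//|_]; rewrite mulr0.
Qed.

(** The divisor [A] is prime to the pole divisor, so that at a pole of [B l.+1] the
    only contribution to the divisor of [B l.+1] is the one of [lam]. *)
Lemma B_pole l i : (l < m)%N -> P i l (B l.+1) < 0 ->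
  [/\ P i l (B l.+1) = - (lam i l.+1)%:Z, (0 < lam i l.+1)%N & coprime (lam i l.+1) p].
Proof.
move=> lt_l Bneg; have [_ _ _ [A [Binf [Apos pole disj divB]]] lamP] := hstd lt_l.
have A0 : coeff (P i l) A = 0.
  have [//|Binf0] := disj (P i l); move: (pole (P i l)); rewrite Binf0.
  by move: Bneg; move: (P i l _) => b; lia.
have PB : P i l (B l.+1) = - (lam i l.+1)%:Z.
  rewrite -divB coeffB A0 sub0r raddf_sum (bigD1 i) //= coeffU eqxx mulr1.
  rewrite big1 ?addr0 // => i' i'i; rewrite coeffU.
  by case: eqP => [/(P_inj (ltnW lt_l))/eqP|_]; rewrite ?(negPf i'i) ?mulr0.
have [lam0|[lam_gt0 lam_p]] := lamP i; last by split.
by rewrite PB lam0 in Bneg.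
Qed.

(** If [y] had a residue [c] at the place of [L], then [y - c] and its conjugate
    would have the same positive value, whereas they differ by a nonzero root of
    [X^p - X], which is a constant. *)
Lemma y_pole l i : (l < m)%N -> P i m (y l.+1) < 0.
Proof.
move=> lt_l; set W := P i m; set z := y l.+1; rewrite ltNge; apply/negP => Wz.
have zT : z \notin T l by apply: y_notin (step_degree lt_l).
have [tot unique] := P_totally_ramified i.
have [sg sgT sgz] : exists2 sg : gal_of {: L}, sg \in ('Gal({: L} / T l))%g & sg z != z.
  apply: contrapT => nsg; case/negP: zT.
  suff : z \in fixedField 'Gal({: L} / T l)%g by rewrite (elimT galois_fixedField (galois_tower l)).
  apply/fixedFieldP; first exact: memvf.
  by move=> sg sgT; apply: contrapT => /eqP sgz; apply: nsg; exists sg.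
have sg1 : sg \in ('Gal({: L} / T 0))%g.
  by apply: (fintype.subsetP _ _ sgT); apply: galS; apply: tower_sub (ltnW lt_l).
have fix1 c : c \in T 0%N -> sg c = c by apply: fixed_gal sg1; apply: subvf.
have conjW u : W (sg u) = W u.
  by apply: (val_conj top_mem _ unique) sg1; exists (p ^ m)%N.
have [c zc] : exists c, vge W 1 (z - cst L c).
  by apply: (residue kcl); rewrite ?top_mem // vgeE // y_neq0.
have szc : vge W 1 (sg (z - cst L c)) by move: zc; rewrite /vge fmorph_eq0 conjW.
have [d dE] : exists d, d = sg z - z by exists (sg z - z).
have d0 : d != 0 by rewrite dE subr_eq0.
have : vge W 1 d.
  rewrite dE; have -> : sg z - z = sg (z - cst L c) - (z - cst L c).
    by rewrite rmorphB /= (fix1 _ (cst_mem _ c)) opprB addrA subrK.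
  by rewrite vgeB ?top_mem.
have dp : d ^+ p = d.
  have hpL := pcharL hp L; have := pFrobenius_autB_comm hpL (mulrC (sg z) z).
  rewrite !pFrobenius_autE -dE => ->.
  have BT := (B_mem lt_l).1.
  have szB : sg z ^+ p - sg z = B l.+1.
    by rewrite -(fixed_gal (subvf _) sgT BT) -step_equation // rmorphB rmorphXn.
  have zB : z ^+ p - z = B l.+1 := step_equation lt_l.
  by rewrite dE; apply/eqP; rewrite -subr_eq0 -(subrr (B l.+1)) -{1}szB -zB; apply/eqP; ring.
rewrite vgeE //; have := valX W p (top_mem d) d0; rewrite dp.
by have := p_gt1 hp; move: (W d) p; clear => *; nia.
Qed.

Lemma val_AS_pole (E : {subfield L}) (Q : place E) z : z \in E -> Q z < 0 ->
  Q (z ^+ p - z) = p%:Z * Q z.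
Proof.
move=> Ez Qz; have z0 : z != 0 by apply: contraTneq Qz => ->; rewrite val0.
rewrite -(valX _ _ Ez z0).
apply: (val_addr (rpredX _ Ez) _ (expf_neq0 _ z0) _).2; first by rewrite rpredN.
rewrite vgeN // vgeE // valX //.
by have := p_gt1 hp; move: (Q z) p Qz; clear => *; nia.
Qed.

Lemma val_B_top l i : (l < m)%N -> P i m (B l.+1) = p%:Z * P i m (y l.+1).
Proof. by move=> lt_l; rewrite -step_equation // val_AS_pole ?top_mem ?y_pole. Qed.

(** Let [r = a / b] be the index of the step.  Comparing the values of [y l.+1] and
    [B l.+1] gives that [p] divides [r * lam], and [lam] is prime to [p]. *)
Lemma ram_step l i a b : (l < m)%N -> ram_index (P i l) (P i m) a ->
  ram_index (P i l.+1) (P i m) b -> (p * b <= a)%N.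
Proof.
move=> lt_l [a0 Wa] [b0 Wb]; have [BT B0] := B_mem lt_l.
have WB := val_B_top i lt_l; have := y_pole i lt_l.
rewrite (Wb _ (y_mem lt_l) (y_neq0 lt_l)) (Wa _ BT B0) in WB *.
set q := P i l.+1 _ in WB *; rewrite pmulr_rlt0 // => q0.
have PB : P i l (B l.+1) < 0.
  by rewrite -(pmulr_rlt0 _ (a0 : 0 < a%:Z)) WB !pmulr_rlt0 ?ltz_nat ?(ltnW (p_gt1 hp)).
have [PBE lam0 lam_p] := B_pole lt_l PB; rewrite PBE in WB.
have [t [Tt t0 Pt]] := uniformizerE (P i l).
have := Wa _ Tt t0; rewrite Pt (Wb _ (subvP (tower_step lt_l) _ Tt) t0) mulr1.
set r := P i l.+1 t => br; have r0 : 0 < r by move: br a0 b0; clear; nia.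
have rl : r * (lam i l.+1)%:Z = p%:Z * - q.
  apply: (@mulfI _ b%:Z); first by rewrite gt_eqF.
  by rewrite mulrA br mulrCA mulrN mulrN -WB mulrN opprK.
have : (p %| `|r| * lam i l.+1)%N.
  by apply/dvdnP; exists `|q|%N; move: rl r0 q0; clear; nia.
rewrite Gauss_dvdl 1?coprime_sym // => /dvdnP[[|d] rE]; first by move: rE r0; clear; lia.
by move: rE r0 br; clear; rewrite mulSn; nia.
Qed.

(** Each of the [m] steps contributes at least a factor [p], and the total index is
    [p ^ m]. *)
Lemma P_top_ram i l : (l <= m)%N -> ram_index (P i l) (P i m) (p ^ (m - l)).
Proof.
move=> le_l; have [a Wa] := P_below_top le_l (P_lies_over i le_l).
suff -> : (p ^ (m - l))%N = a by [].
have p0 : (0 < p)%N := ltnW (p_gt1 hp).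
have low d : (d <= m)%N -> forall a, ram_index (P i (m - d)%N) (P i m) a -> (p ^ d <= a)%N.
  elim: d => [|d IH] le_d b Wb; first by case: Wb.
  have lt_md : (m - d.+1 < m)%N by lia.
  have [b' Wb'] := P_below_top lt_md (P_lies_over i lt_md).
  apply: leq_trans (ram_step lt_md Wb Wb'); rewrite expnS leq_mul2l.
  by rewrite (IH (ltnW le_d)) ?orbT // -(subnSK le_d).
have up d : (d <= m)%N -> forall a, ram_index (P i d) (P i m) a -> (p ^ d * a <= p ^ m)%N.
  elim: d => [|d IH] lt_d b Wb.
    by have [_ <-] := ram_index_inj Wb (P_totally_ramified i).1; rewrite mul1n.
  have [b' Wb'] := P_below_top (ltnW lt_d) (P_lies_over i (ltnW lt_d)).
  apply: leq_trans (IH (ltnW lt_d) b' Wb'); rewrite expnSr -mulnA leq_mul2l.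
  by rewrite (ram_step lt_d Wb') ?orbT.
apply/eqP; rewrite eqn_leq; apply/andP; split.
  by apply: low; rewrite ?leq_subr ?subKn.
by rewrite -(@leq_pmul2l (p ^ l)) ?expn_gt0 ?p0 // -expnD subnKC // up.
Qed.

(** The index of the step is the quotient of those of [W] over its two ends, where [W]
    is the place [P i m]. *)
Lemma P_step_ram i l : (l < m)%N -> ram_index (P i l) (P i l.+1) p.
Proof.
move=> lt_l; split=> [|z Tz z0]; first exact: ltnW (p_gt1 hp).
have [_ W0] := P_top_ram i (ltnW lt_l); have [pos W1] := P_top_ram i lt_l.
apply: (@mulfI _ (p ^ (m - l.+1))%:Z); first by rewrite gt_eqF.
rewrite -W1 ?(subvP (tower_step lt_l)) // W0 // mulrA -PoszM -expnSr.
by rewrite subnSK.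
Qed.

Lemma P_step_y i l : (l < m)%N ->
  [/\ P i l.+1 (y l.+1) = - (lam i l.+1)%:Z, (0 < lam i l.+1)%N & coprime (lam i l.+1) p].
Proof.
move=> lt_l; have [BT B0] := B_mem lt_l; have WB := val_B_top i lt_l.
have [posl W0] := P_top_ram i (ltnW lt_l); have [pos W1] := P_top_ram i lt_l.
have [PB lam0 lam_p] : [/\ P i l (B l.+1) = - (lam i l.+1)%:Z,
    (0 < lam i l.+1)%N & coprime (lam i l.+1) p].
  apply: B_pole => //; rewrite -(pmulr_rlt0 _ (posl : 0 < (_%:Z))) -W0 // WB.
  by rewrite pmulr_rlt0 ?y_pole // ltz_nat (ltnW (p_gt1 hp)).
split=> //; move: WB; rewrite W0 // W1 ?y_mem ?y_neq0 // PB mulrA -PoszM.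
rewrite -[(p * _)%N]expnS subnSK // => /mulfI->//.
by rewrite gt_eqF.
Qed.

(** The values of the terms are distinct modulo [p], because [lam] is prime to [p]
    and the exponents are less than [p]. *)
Lemma P_expand i l (G : {poly L}) : (l < m)%N -> G \is a polyOver (T l) ->
    (size G <= p)%N -> G != 0 ->
  [/\ exists n, G`_n != 0 /\
        P i l.+1 G.[y l.+1] = p%:Z * P i l G`_n - n%:Z * (lam i l.+1)%:Z &
      forall n, G`_n != 0 ->
        P i l.+1 G.[y l.+1] <= p%:Z * P i l G`_n - n%:Z * (lam i l.+1)%:Z].
Proof.
move=> lt_l TG sG G0; have TGc n : G`_n \in T l by move/polyOverP: TG.
have TE := subvP (tower_step lt_l); have Ty := y_mem lt_l; have y0 := y_neq0 lt_l.
have [Py lam0 lam_p] := P_step_y i lt_l; have [_ PP] := P_step_ram i lt_l.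
have valE n : G`_n != 0 ->
    P i l.+1 (G`_n * y l.+1 ^+ n) = p%:Z * P i l G`_n - n%:Z * (lam i l.+1)%:Z.
  move=> Gn; rewrite val_atM ?rpredX ?expf_neq0 ?(TE _ (TGc n)) //.
  by rewrite (PP _ (TGc n)) // valX // Py mulrN.
pose u (n : 'I_p) := G`_n * y l.+1 ^+ n.
have u0 (n : 'I_p) : (u n != 0) = (G`_n != 0) by rewrite mulf_eq0 expf_eq0 (negPf y0) andbF orbF.
have lt_n : ((size G).-1 < p)%N by rewrite prednK ?size_poly_gt0.
have := @val_sum_distinct _ _ _ (P i l.+1) _ u (Ordinal lt_n).
rewrite u0 -/(lead_coef G) lead_coef_eq0 G0 => /(_ isT)[].
- by move=> n; rewrite rpredM ?rpredX ?(TE _ (TGc n)).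
- move=> n n'; rewrite !u0 => Gn Gn'; rewrite !valE // => eq_val; apply: ord_inj.
  wlog le_n : n n' Gn Gn' eq_val / (n <= n')%N.
    by move=> H; case: (leqP n n') => [|/ltnW] /H -> //.
  have : (p %| (n' - n) * lam i l.+1)%N.
    suff : (p%:Z %| ((n' - n) * lam i l.+1)%N%:Z)%Z by [].
    apply/dvdzP; exists (P i l G`_n' - P i l G`_n); rewrite PoszM -subzn // !mulrBl.
    by move: eq_val; clear; move: (P i l _) (P i l _) => a a'; lia.
  rewrite Gauss_dvdl 1?coprime_sym // => /dvdnP[q].
  by have := ltn_ord n'; move: le_n; clear; case: q => [|q]; rewrite ?mul0n ?mulSn; lia.
have -> : \sum_j u j = G.[y l.+1] by rewrite (horner_coef_wide _ sG).
move=> n [un min_n _ ->]; rewrite u0 in un; split.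
  by exists n; rewrite valE.
move=> n' Gn'; rewrite valE // -valE //.
have lt_n' : (n' < p)%N.
  by rewrite ltnNge; apply: contra Gn' => le_p; rewrite nth_default // (leq_trans sG).
by have := min_n (Ordinal lt_n'); rewrite vgeE ?u0 // !valE.
Qed.

(** At another listed place, every term of [f] has value at least that of [f].  At
    a place that is not listed, [B l.+1] is regular and the places above it used in
    [AS_integral] are unramified, hence different from [P i l.+1]. *)
Lemma coef_regular i l f : (l < m)%N -> f \in T l.+1 ->
    (forall Q : place (T l.+1), Q <> P i l.+1 -> vge Q 0 f) ->
  forall n (Q : place (T l)), Q <> P i l -> vge Q 0 (Fadjoin_poly (T l) (y l.+1) f)`_n.
Proof.
move=> lt_l Tf regf n Q QP; set G := Fadjoin_poly _ _ _.
have TE : T l.+1 = <<T l; y l.+1>>%AS by have [] := hstd lt_l.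
have dimT := step_degree lt_l.
have TG : G \is a polyOver (T l) by apply: Fadjoin_polyOver.
have sG : (size G <= p)%N by rewrite -dimT -adjoin_degreeE size_Fadjoin_poly.
have Gy : G.[y l.+1] = f.
  by rewrite Fadjoin_poly_eq // -[<<_; _>>%VS]/(<<T l; y l.+1>>%AS : {vspace L}) -TE.
have [G0|G0] := eqVneq G 0; first by rewrite G0 coef0 vge0.
have [BT B0] := B_mem lt_l.
have [[i' Qi']|nQ] := pselect (exists i', Q = P i' l); last first.
  apply: (AS_integral kcl hp dimT (step_equation lt_l) BT _ TG sG).
    by rewrite vgeE // (B_regular) // => i' Qi'; apply: nQ; exists i'.
  (* The two sides of [TE] are not convertible, hence neither are their places. *)
  suff H (E : {subfield L}) : E = T l.+1 ->
      forall w : place E, ram_index Q w 1 -> vge w 0 G.[y l.+1] by apply: H.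
  move=> -> w Qw; rewrite Gy; apply: regf => wP; apply: QP.
  rewrite wP in Qw; by have [] := ram_index_inj Qw (P_step_ram i lt_l).
have [_ /(_ n)] := P_expand i' lt_l TG sG G0.
rewrite Gy /vge; case: eqP => //= _ /(_ isT); subst Q => le_n.
have : vge (P i' l.+1) 0 f.
  apply: regf => eqP; apply: QP; congr (P _ l).
  exact: (P_inj (l := l.+1)) eqP.
have f0 : f != 0.
  by apply: contraNneq G0 => f0; rewrite /G f0 raddf0.
rewrite vgeE // => f_ge0; rewrite -(pmulr_rge0 _ (ltnW (p_gt1 hp) : 0 < p%:Z)).
apply: le_trans (le_trans f_ge0 le_n) _.
by rewrite gerBl mulr_ge0.
Qed.

(** Induction along the tower: one coefficient of [f] over [T j] determines the
    value of [f], and it has no pole away from [P i j].  At the bottom, a function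
    with positive value at its only possible pole would be constant, and nonzero
    constants have value 0. *)
Lemma value_in_semigroup i j f : (j <= m)%N -> f \in T j -> f != 0 ->
    (forall Q : place (T j), Q <> P i j -> vge Q 0 f) ->
  exists2 a, ramification_semigroup p (lam i) j a & P i j f = - a%:Z.
Proof.
elim: j f => [|j IH] f le_j Tf f0 regf.
  have Pf : P i 0%N f <= 0.
    rewrite leNgt; apply/negP => Pf.
    have [c fc] : exists c, f = cst L c.
      suff H (E : {subfield L}) : E = 1%AS -> f \in E ->
          (forall Q : place E, vge Q 0 f) -> exists c, f = cst L c.
        apply: H T0E Tf _ => Q; have [->|nQ] := pselect (Q = P i 0%N); last exact: regf.
        by rewrite vgeE // ltW.
      by move=> ->; apply: (mem1_no_pole kcl).
    by rewrite fc val_at_cst ?ltxx // -(cst_eq0 L) -fc in Pf.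
  exists `|P i 0%N f|%N; last by rewrite lez0_abs ?opprK.
  by exists (fun=> `|P i 0%N f|%N); rewrite big_geq // addn0 expn0 mul1n.
set G := Fadjoin_poly (T j) (y j.+1) f.
have TE : T j.+1 = <<T j; y j.+1>>%AS by have [] := hstd le_j.
have TG : G \is a polyOver (T j) by apply: Fadjoin_polyOver.
have sG : (size G <= p)%N.
  by rewrite -(step_degree le_j) -adjoin_degreeE size_Fadjoin_poly.
have Gy : G.[y j.+1] = f.
  by rewrite Fadjoin_poly_eq // -[<<_; _>>%VS]/(<<T j; y j.+1>>%AS : {vspace L}) -TE.
have G0 : G != 0 by apply: contraNneq f0 => G0; rewrite -Gy G0 horner0.
have [[n [Gn Pf]] _] := P_expand i le_j TG sG G0; rewrite -Gy Pf.
have [||a' a'S ->] := IH G`_n (ltnW le_j) _ Gn.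
- by move/polyOverP: TG.
- by move=> Q; apply: coef_regular.
exists (p * a' + lam i j.+1 * n)%N; first exact: ramification_semigroup_step.
by rewrite PoszD !PoszM mulrN opprD [_ * n%:Z]mulrC.
Qed.

Lemma weierstrass_sub i j : (j <= m)%N ->
  (weierstrass_semigroup (P i j) `<=` ramification_semigroup p (lam i) j)%classic.
Proof.
move=> le_j a [f [Tf f0 polef]].
have [|b bS Pf] := value_in_semigroup le_j Tf f0 (i := i).
  move=> Q QP; have := polef Q; rewrite coeffU vgeE //.
  by case: eqP => [/esym//|_]; rewrite mulr0; move: (Q f) => q; lia.
have := polef (P i j); rewrite coeffU eqxx mulr1 Pf opprK.
by move=> ab; suff -> : a = b by []; move: ab; clear; lia.
Qed.

(** The element is [t ^+ c 0 * y 1 ^+ c 1 * ... * y j ^+ c j], where [t] has a simple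
    pole at the bottom place.  When that place is the only one listed, every [B l]
    and hence every [y l] is regular at the places not above it. *)
Lemma semigroup_value i j a : (forall i', i' = i) -> (j <= m)%N ->
    ramification_semigroup p (lam i) j a ->
  exists f, [/\ f \in T j, f != 0, P i j f = - a%:Z &
    forall Q : place (T j), Q <> P i j -> 0 <= Q f].
Proof.
move=> only; elim: j a => [|j IH] a le_j.
  case=> c ->; rewrite big_geq // addn0 expn0 mul1n.
  have [t [Tt t0 Pt tQ]] : exists t, [/\ t \in T 0%N, t != 0, P i 0%N t = -1 &
      forall Q : place (T 0%N), Q <> P i 0%N -> 0 <= Q t].
    suff H (E : {subfield L}) : E = 1%AS -> forall P0 : place E,
      exists t, [/\ t \in E, t != 0, P0 t = -1 &
      forall Q : place E, Q <> P0 -> 0 <= Q t] by apply: H T0E _.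
    by move=> -> P0; apply: (mem1_simple_pole kcl).
  exists (t ^+ c 0%N); split; rewrite ?rpredX ?expf_neq0 //.
    by rewrite valX // Pt mulrN1.
  by move=> Q QP; rewrite valX // mulr_ge0 ?tQ.
case/ramification_semigroupS=> a' [n [/(IH _ (ltnW le_j))[f [Tf f0 Pf fQ]] ->]].
have Tj := subvP (tower_step le_j); have [Py _ _] := P_step_y i le_j.
have [_ PP] := P_step_ram i le_j; have Ty := y_mem le_j; have y0 := y_neq0 le_j.
have [TB B0] := B_mem le_j.
exists (f * y j.+1 ^+ n); split; rewrite ?mulf_neq0 ?expf_neq0 ?rpredM ?rpredX ?(Tj _ Tf) //.
  rewrite val_atM ?rpredX ?expf_neq0 ?(Tj _ Tf) // valX // Py PP // Pf.
  by rewrite PoszD !PoszM !mulrN -opprD [n%:Z * _]mulrC.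
move=> Q QP; have [Q0 [e [e0 QQ0]]] := place_restrict Q (tower_step le_j).
have Q0P : Q0 <> P i j.
  move=> Q0E; apply: QP; apply: (P_unique le_j).
  have [e' Pe'] := P_lies_over i (ltnW le_j); exists (e * e')%N.
  rewrite Q0E in QQ0; apply: (ram_index_trans _ Pe'); last by split.
  exact: (tower_sub (leq0n j) (ltnW le_j)).
have Qf : 0 <= Q f by rewrite QQ0 // mulr_ge0 ?fQ.
have QB : 0 <= Q (B j.+1).
  rewrite QQ0 // mulr_ge0 // (B_regular) // => i'; rewrite (only i'); exact: Q0P.
have Qy : 0 <= Q (y j.+1).
  rewrite leNgt; apply/negP => Qy; move: QB; rewrite -(step_equation le_j) (val_AS_pole) //.
  by rewrite leNgt pmulr_rlt0 ?Qy // ltz_nat (ltnW (p_gt1 hp)).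
by rewrite val_atM ?rpredX ?expf_neq0 ?(Tj _ Tf) // valX // addr_ge0 ?mulr_ge0.
Qed.

Lemma weierstrass_eq i j : (forall i', i' = i) -> (j <= m)%N ->
  weierstrass_semigroup (P i j) = ramification_semigroup p (lam i) j.
Proof.
move=> only le_j; apply/seteqP; split=> [|a /(semigroup_value only le_j)[f [Tf f0 Pf fQ]]].
  exact: weierstrass_sub.
exists f; split=> // Q; rewrite coeffU; case: eqP => [<-|/nesym QP].
  by rewrite Pf opprK mulr1; clear; lia.
by rewrite mulr0; have := fQ Q QP; move: (Q f) => q; clear; lia.
Qed.

End Tower.

Theorem proposition28 (k : closedFieldType) (p : nat) (hp : p \in [pchar k])
  (L : splittingFieldType (ratfun k)) (m : nat)
  (hgal : galois 1%AS {: L}%AS)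
  (hcyc : cyclic 'Gal({: L}%AS / 1%AS))
  (hdeg : \dim {: L}%AS = (p ^ m)%N)
  (T : nat -> {subfield L}) (hT : degree_p_tower p m T)
  (htot : forall Q : place (T 0%N), ramified (T m) Q -> totally_ramified (T m) Q)
  (s : nat) (P : 'I_s -> forall j, place (T j)) (hP : ramified_places m P)
  (y B : nat -> L) (lam : 'I_s -> nat -> nat)
  (hstd : standard_form p m P y B lam)
  (i0 : 'I_s) :
  [/\ (forall j, (j <= m)%N ->
         weierstrass_semigroup (P i0 j)
           `<=` ramification_semigroup p (lam i0) j)%classic,
      (weierstrass_semigroup (P i0 m)
         `<=` ramification_semigroup p (lam i0) m)%classic &
      (forall Q : place (T 0%N), ramified (T m) Q -> Q = P i0 0%N) ->
      (forall j, (j <= m)%N ->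
         weierstrass_semigroup (P i0 j) = ramification_semigroup p (lam i0) j)
      /\ weierstrass_semigroup (P i0 m) = ramification_semigroup p (lam i0) m].
Proof.
have kcl : alg_closed k by move=> f; have [r fE] := closed_field_poly_normal f; exists r.
split=> [j le_j||only].
- exact (weierstrass_sub kcl hp hgal hdeg hT htot hP hstd le_j).
- exact (weierstrass_sub kcl hp hgal hdeg hT htot hP hstd (leqnn m)).
have only_i0 i : i = i0.
  case: (hP) => injP ram _; apply: injP; apply: only; apply/ram; by exists i.
split=> [j le_j|].
- exact (weierstrass_eq kcl hp hgal hdeg hT htot hP hstd only_i0 le_j).
- exact (weierstrass_eq kcl hp hgal hdeg hT htot hP hstd only_i0 (leqnn m)).
Qed.
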